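(* Let $\boldsymbol\psi$ be a parabolic filtration of $\Phi$ of depth at most $r$ with Levi factor $\boldsymbol\phi$, let $\boldsymbol\lambda\in\mathfrak Z_{\boldsymbol\phi}^\vee\subseteq\mathfrak t_r^\vee$, and let $\mathcal O_{\boldsymbol\lambda}=G_r\cdot\boldsymbol\lambda\subseteq\mathfrak g_r^\vee$ be its coadjoint orbit. The following are equivalent: (1) the pairing $B^{\boldsymbol\psi}_{\boldsymbol\lambda}\colon\mathfrak u^+_{\boldsymbol\psi}\otimes\mathfrak u^-_{\boldsymbol\psi}\to\mathbb C$ is the restriction of the Kirillov–Kostant–Souriau symplectic form of $\mathcal O_{\boldsymbol\lambda}$, evaluated at $\boldsymbol\lambda$, onto the subspace $\mathfrak u^+_{\boldsymbol\psi}\otimes\mathfrak u^-_{\boldsymbol\psi}\subseteq\bigwedge^2(\mathfrak u^+_{\boldsymbol\psi}\oplus\mathfrak u^-_{\boldsymbol\psi})$ (i.e. the natural map $\mathfrak u^+_{\boldsymbol\psi}\oplus\mathfrak u^-_{\boldsymbol\psi}\to\mathfrak g_r/\mathfrak g_r^{\boldsymbol\lambda}\simeq T_{\boldsymbol\lambda}\mathcal O_{\boldsymbol\lambda}$ is an isomorphism, under which $B^{\boldsymbol\psi}_{\boldsymbol\lambda}$ is the corresponding restriction of the KKS form); (2) $\boldsymbol\lambda$ lies in the stratum $\mathfrak t^{\vee,r}_{\boldsymbol\phi^\vee}$; (3) $\mathfrak l_{\boldsymbol\phi}=\mathfrak g_r^{\boldsymbol\lambda}$.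
   Context: $G$ is a connected complex reductive Lie group with Lie algebra $\mathfrak g$, Cartan subalgebra $\mathfrak t$, roots $\Phi$, root spaces $\mathfrak g_\alpha$, coroots $\alpha^\vee\in\mathfrak t$. $r\ge1$, $\mathbb C_r=\mathbb C[[z]]/z^r\mathbb C[[z]]$, $\varepsilon$ = class of $z$, $G_r=G(\mathbb C_r)$, $\mathfrak g_r=\bigoplus_{i=0}^{r-1}\mathfrak g\varepsilon^i$, $\mathfrak t_r=\mathfrak t\otimes\mathbb C_r$. A subset $\psi\subseteq\Phi$ is parabolic if it is closed under sums within $\Phi$ and $\psi\cup(-\psi)=\Phi$. A parabolic filtration of depth at most $r$ is a sequence $\boldsymbol\psi=(\psi_i)_{i\ge0}$ of parabolic subsets with $\psi_i\subseteq\psi_{i+1}$ and $\psi_i=\Phi$ for $i\ge r$; Levi factor $\boldsymbol\phi$: $\phi_i=\psi_i\cap(-\psi_i)$. Let $\mathfrak l_{\boldsymbol\phi}=\bigoplus_{i<r}(\mathfrak t\oplus\bigoplus_{\phi_i}\mathfrak g_\alpha)\varepsilon^i$ and $\mathfrak u^\pm_{\boldsymbol\psi}=\bigoplus_{i<r}(\bigoplus_{\alpha\in\psi_i\setminus\phi_i}\mathfrak g_{\pm\alpha})\varepsilon^i$; then $\mathfrak g_r=\mathfrak u^-_{\boldsymbol\psi}\oplus\mathfrak l_{\boldsymbol\phi}\oplus\mathfrak u^+_{\boldsymbol\psi}$, with projection $\pi_{\boldsymbol\phi}\colon\mathfrak g_r\to\mathfrak l_{\boldsymbol\phi}$. $\mathfrak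 Z_{\boldsymbol\phi}^\vee$ is the set of $\boldsymbol\lambda=(\lambda_0,\dots,\lambda_{r-1})\in(\mathfrak t^\vee)^r\simeq\mathfrak t_r^\vee$ (with $\boldsymbol\lambda(X\varepsilon^i)=\lambda_i(X)$) such that $\lambda_i(\alpha^\vee)=0$ for all $\alpha\in\phi_i$, $0\le i\le r-1$; the stratum $\mathfrak t^{\vee,r}_{\boldsymbol\phi^\vee}$ is the subset where moreover $\lambda_i(\alpha^\vee)\neq0$ for all $\alpha\in\phi_{i+1}\setminus\phi_i$, $0\le i\le r-1$. $\boldsymbol\lambda$ is viewed in $\mathfrak g_r^\vee$ by extending it by zero on all $\mathfrak g_\alpha\otimes\mathbb C_r$; $\mathfrak g_r^{\boldsymbol\lambda}=\{\boldsymbol Y\in\mathfrak g_r:\operatorname{ad}^\vee_{\boldsymbol Y}\boldsymbol\lambda=0\}$. The restriction of $\boldsymbol\lambda$ to $\mathfrak l_{\boldsymbol\phi}$ is a character $\boldsymbol\chi$, and $B^{\boldsymbol\psi}_{\boldsymbol\lambda}(\boldsymbol Y,\boldsymbol Y')=\langle\boldsymbol\chi,\pi_{\boldsymbol\phi}([\boldsymbol Y,\boldsymbol Y'])\rangle$ for $\boldsymbol Y\in\mathfrak u^+_{\boldsymbol\psi}$, $\boldsymbol Y'\in\mathfrak u^-_{\boldsymbol\psi}$. The KKS form at $\boldsymbol\lambda$, on $T_{\boldsymbol\lambda}\mathcal O_{\boldsymbol\lambda}\simeq\mathfrak g_r/\mathfrak g_r^{\boldsymbol\lambda}$, is induced by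 $\boldsymbol Y\wedge\boldsymbol Y'\mapsto\langle\boldsymbol\lambda,[\boldsymbol Y,\boldsymbol Y']\rangle$. *)

(* Defs.v *)
From HB Require Import structures.
From mathcomp Require Import all_boot all_order all_algebra finmap complex.
From mathcomp Require Import boolp classical_sets cardinality reals.

Set Implicit Arguments.
Unset Strict Implicit.
Unset Printing Implicit Defensive.

Import GRing.Theory.
Local Open Scope ring_scope.

HB.mixin Record isLieAlgebra (F : fieldType) V of Vector F V := {
  lie : V -> V -> V;
  lie_is_linearl : forall y, linear (fun x => lie x y);
  lie_is_linearr : forall x, linear (lie x);
  liexx : forall x, lie x x = 0;
  lie_jacobi : forall x y z,
    lie x (lie y z) + lie y (lie z x) + lie z (lie x y) = 0
}.

#[short(type="lieAlgType")]
HB.structure Definition LieAlgebra (F : fieldType) :=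
  {V of isLieAlgebra F V & Vector F V}.

Definition dual (F : fieldType) (V : vectType F) := 'Hom(V, F^o).

Section LieAlgebras.
Context {F : fieldType} {L : lieAlgType F}.
Implicit Types (x y : L) (f : dual L) (U V I : {vspace L}).

HB.instance Definition _ x :=
  GRing.isLinear.Build F L L *:%R (lie x) (lie_is_linearr x).

Definition lier y x := lie x y.
HB.instance Definition _ y :=
  GRing.isLinear.Build F L L *:%R (lier y) (lie_is_linearl y).

Lemma lieC x y : lie y x = - lie x y.
Proof.
apply/eqP; rewrite -addr_eq0; have := liexx (x + y).
rewrite linearD /= -!/(lier _ (x + y)) !linearD /= /lier !liexx.
by rewrite add0r addr0 => /eqP.
Qed.

Definition ad x : 'End(L) := linfun (lie x).

Lemma adE x y : ad x y = lie x y.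
Proof. by rewrite lfunE. Qed.

Definition lie_prod U V : {vspace L} :=
  <<[seq lie x y | x <- vbasis U, y <- vbasis V]>>%VS.

Lemma mem_lie_prod U V x y : x \in U -> y \in V -> lie x y \in lie_prod U V.
Proof.
move=> /coord_vbasis -> /coord_vbasis ->; rewrite -/(lier _ _) linear_sum /=.
apply: memv_suml => i _; rewrite /lier linear_sum /=; apply: memv_suml => j _.
rewrite -/(lier _ _) linearZ /= /lier linearZ /=; do 2! apply: memvZ.
by apply/memv_span/allpairs_f; rewrite mem_nth ?size_tuple.
Qed.

Definition lie_ideal I : Prop := forall x y, y \in I -> lie x y \in I.

Definition derived_series U n := iter n (fun V => lie_prod V V) U.

Definition lie_solvable U : Prop := exists n, derived_series U n = 0%VS.

(* The radical equals the centre; only one inclusion has content. *)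
Definition reductive : Prop :=
  forall I, lie_ideal I -> lie_solvable I ->
  forall x y, x \in I -> lie x y = 0.

Definition lie_commutative U : Prop := {in U &, forall x y, lie x y = 0}.

Definition ad_semisimple x : Prop :=
  exists2 b : seq L, basis_of fullv b &
    forall v, v \in b -> exists a : F, ad x v = a *: v.

Definition cartan_subalgebra (t : {vspace L}) : Prop :=
  [/\ lie_commutative t,
      forall U, (t <= U)%VS -> lie_commutative U -> U = t
    & forall h, h \in t -> ad_semisimple h].

(* <ad^vee_y f, z> = - <f, [y, z]> *)
Definition coad f y : dual L := linfun (fun z => - (f (lie y z) : F^o)).

Fact coad_f_is_linear f y : linear (fun z => - (f (lie y z) : F^o)).
Proof. by move=> a u v; rewrite !linearP. Qed.

Lemma coadE f y z : coad f y z = - f (lie y z).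
Proof.
rewrite /coad; pose h := GRing.isLinear.Build F L F^o *:%R _ (coad_f_is_linear f y).
pose H : {linear L -> F^o} := HB.pack (fun z => - (f (lie y z) : F^o)) h.
exact: (lfunE H).
Qed.

Fact coad_is_linear f : linear (coad f).
Proof.
move=> a u v; apply/lfunP => z; rewrite add_lfunE scale_lfunE !coadE.
by rewrite -!/(lier z _) !linearP.
Qed.
HB.instance Definition _ f :=
  GRing.isLinear.Build F L (dual L) *:%R (coad f) (coad_is_linear f).

(* The differential at the identity of the orbit map a |-> Ad^vee_a f. *)
Definition coad_at f : 'Hom(L, dual L) := linfun (coad f).

Lemma coad_atE f y : coad_at f y = coad f y.
Proof. by rewrite lfunE. Qed.

Definition coad_stab f : {vspace L} := lker (coad_at f).

Lemma coad_stabP f y :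
  reflect (forall z, f (lie y z) = 0) (y \in coad_stab f).
Proof.
rewrite memv_ker coad_atE; apply: (iffP eqP) => [h z | h].
  by apply: oppr_inj; rewrite -coadE h zero_lfunE oppr0.
by apply/lfunP => z; rewrite coadE h zero_lfunE oppr0.
Qed.

(* The tangent space at f of the orbit of f under a connected group with Lie
   algebra L, as a subspace of the dual; it depends on L only, and coad_at f
   induces the identification of L / coad_stab f with it. *)
Definition orbit_tangent f : {vspace dual L} := limg (coad_at f).

(* The Kirillov-Kostant-Souriau form; by kksE it does not depend on the
   preimages under coad_at f. *)
Definition kks f (v w : subvs_of (orbit_tangent f)) : F :=
  f (lie ((coad_at f)^-1%VF (vsval v)) ((coad_at f)^-1%VF (vsval w))).

Definition to_tangent f y : subvs_of (orbit_tangent f) :=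
  vsproj (orbit_tangent f) (coad_at f y).

Lemma to_tangentE f y : vsval (to_tangent f y) = coad_at f y.
Proof. by rewrite vsprojK ?memv_img ?memvf. Qed.

Lemma kksE f y y' : kks (to_tangent f y) (to_tangent f y') = f (lie y y').
Proof.
rewrite /kks !to_tangentE.
have stab z : (coad_at f)^-1%VF (coad_at f z) - z \in coad_stab f.
  by rewrite memv_ker linearB /= limg_lfunVK ?subrr ?memv_img ?memvf.
have eql u v : f (lie ((coad_at f)^-1%VF (coad_at f u)) v) = f (lie u v).
  apply/eqP; rewrite -subr_eq0 -linearB -!/(lier v _) -linearB /lier /=.
  by rewrite (coad_stabP _ _ (stab u)).
by rewrite eql lieC linearN /= eql -linearN /= -lieC.
Qed.

End LieAlgebras.

Arguments reductive {F} L.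

Section Roots.
Context {F : fieldType} {g : lieAlgType F} (t : {vspace g}).
Local Notation tdual := (dual (subvs_of t)).
Implicit Types (a : tdual) (psi : {fset tdual}).

Definition root_space a : {vspace g} :=
  (\bigcap_(h <- vbasis {: subvs_of t})
     lker (ad (vsval h) - (a h : F) *: \1%VF))%VS.

Lemma root_spaceP a x :
  reflect (forall h, lie (vsval h) x = (a h : F) *: x) (x \in root_space a).
Proof.
have -> : (x \in root_space a) = all (fun h : subvs_of t =>
    lie (vsval h) x == (a h : F) *: x) (vbasis {: subvs_of t}).
  rewrite /root_space; elim: (tval _) => [|h s IH]; first by rewrite big_nil memvf.
  rewrite big_cons memv_cap IH /= memv_ker add_lfunE opp_lfunE scale_lfunE.
  by rewrite id_lfunE lfunE subr_eq0.
apply: (iffP allP) => [xa h | xa h _]; last exact/eqP.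
have hf : h \in <<vbasis {: subvs_of t}>>%VS.
  by rewrite (span_basis (vbasisP _)) memvf.
rewrite (coord_span hf) !linear_sum /= -/(lier x _) linear_sum scaler_suml.
apply: eq_bigr => i _; rewrite !linearZ /= /lier.
by rewrite (eqP (xa _ _)) ?scalerA // mem_nth // size_tuple.
Qed.

Definition is_root a : bool := (a != 0) && (root_space a != 0%VS).

Lemma root_space_free (s : seq tdual) (v : tdual -> g) :
  uniq s -> (forall a, v a \in root_space a) -> \sum_(a <- s) v a = 0 ->
  forall a, a \in s -> v a = 0.
Proof.
elim: s v => [//|b s IH] v /= /andP[bs us] vr.
rewrite big_cons => v0.
have vs a : a \in s -> v a = 0.
  move=> as_; have /lfunPn [h neh] : a != b by apply: contraNneq bs => <-.
  pose w (c : tdual) := (c h - b h : F) *: v c.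
  have /eqP : w a = 0.
    apply: (IH w) => // [c|]; first by rewrite memvZ.
    have vb : v b = - \sum_(c <- s) v c by apply/eqP; rewrite -addr_eq0 v0.
    have := congr1 (lie (vsval h)) v0.
    rewrite linear0 linearD linear_sum /= (root_spaceP _ _ (vr b) h) vb scalerN.
    move/eqP; rewrite addrC subr_eq0 scaler_sumr => /eqP e.
    rewrite -[RHS](subrr (\sum_(c <- s) (b h : F) *: v c)) -[X in _ = X - _]e.
    rewrite -sumrB; apply: eq_bigr => c _.
    by rewrite (root_spaceP _ _ (vr c)) /w scalerBl.
  by rewrite scaler_eq0 subr_eq0 (negPf neh) => /eqP.
move=> a; rewrite inE => /predU1P[->|/vs//].
by move: v0; rewrite big_seq big1 ?addr0.
Qed.

Local Open Scope classical_set_scope.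

Lemma finite_is_root : finite_set [set a | is_root a].
Proof.
apply: contrapT => /(infinite_set_fset (\dim {:g}).+1) [X XR nX].
pose v a := vpick (root_space a).
have vr a : v a \in root_space a by exact: memv_pick.
have v0 a : a \in X -> v a != 0.
  by move=> /XR /andP[_]; rewrite vpick0.
pose s := in_tuple X; pose vs := [tuple v (tnth s i) | i < size X].
have s_inj : injective (tnth s) by exact/tuple_uniqP/fset_uniq.
suff /eqP fvs : free vs.
  have := dimvS (subvf <<vs>>%VS); rewrite fvs size_tuple => /(leq_trans nX).
  by rewrite ltnn.
apply/freeP => k k0 i.
pose w (a : tdual) := \sum_(j | tnth s j == a) k j *: v a.
have wE j : w (tnth s j) = k j *: v (tnth s j).
  by rewrite /w (big_pred1 j) // => j' /=; rewrite (inj_eq s_inj).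
have wr a : w a \in root_space a by apply: memv_suml => j _; exact: memvZ.
have w0 : \sum_(a <- s) w a = 0.
  rewrite big_tnth -[RHS]k0; apply: eq_bigr => j _.
  by rewrite wE (nth_map j) ?size_enum_ord // nth_ord_enum.
have := root_space_free (fset_uniq X) wr w0 (mem_tnth i s).
rewrite wE => /eqP; rewrite scaler_eq0 (negPf (v0 _ _)) ?orbF => [/eqP //|].
exact: mem_tnth.
Qed.

(* A genuine enumeration of the roots, by finite_is_root. *)
Definition roots : {fset tdual} := fset_set [set a | is_root a].

Lemma in_roots a : (a \in roots) = is_root a.
Proof.
rewrite in_fset_set; last exact: finite_is_root.
by apply/idP/idP; rewrite inE.
Qed.

(* The coroot of a is the element h of [g_a, g_(-a)] with a(h) = 2. *)
Definition is_coroot a : set (subvs_of t) :=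
  [set h | vsval h \in lie_prod (root_space a) (root_space (- a)) /\ a h = 2].

Definition coroot a : subvs_of t := xget 0 (is_coroot a).

Local Close Scope classical_set_scope.
Definition parabolic psi : Prop :=
  [/\ (psi `<=` roots)%fset,
      forall a b, a \in psi -> b \in psi -> a + b \in roots -> a + b \in psi
    & (psi `|` [fset (- a)%R | a in psi])%fset = roots].

Definition parabolic_filtration (r : nat) (psi : nat -> {fset tdual}) : Prop :=
  [/\ forall i, parabolic (psi i),
      forall i, (psi i `<=` psi i.+1)%fset
    & forall i, (r <= i)%N -> psi i = roots].

Definition levi_factor (psi : nat -> {fset tdual}) (i : nat) : {fset tdual} :=
  (psi i `&` [fset (- a)%R | a in psi i])%fset.

End Roots.

(* current r g = g (x) F[z]/(z^r); Y : current r g stands for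
   \sum_i (Y i) eps^i. *)
Definition current (r : nat) (g : Type) := {ffun 'I_r -> g}.

Section Current.
Context {F : fieldType} (r : nat) {g : lieAlgType F}.
Local Notation g_r := (current r g).

HB.instance Definition _ := Vector.copy g_r {ffun 'I_r -> g}.

Definition current_lie (Y Z : g_r) : g_r :=
  [ffun k : 'I_r => \sum_(i < r) \sum_(j < r | (i + j == k)%N) lie (Y i) (Z j)].

Fact current_lie_is_linearl Z : linear (fun Y => current_lie Y Z).
Proof.
move=> a u v; apply/ffunP => k; rewrite !ffunE scaler_sumr -big_split /=.
apply: eq_bigr => i _; rewrite scaler_sumr -big_split /=.
by apply: eq_bigr => j _; rewrite !ffunE -!/(lier (Z j) _) linearP.
Qed.

Fact current_lie_is_linearr Y : linear (current_lie Y).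
Proof.
move=> a u v; apply/ffunP => k; rewrite !ffunE scaler_sumr -big_split /=.
apply: eq_bigr => i _; rewrite scaler_sumr -big_split /=.
by apply: eq_bigr => j _; rewrite !ffunE linearP.
Qed.

Fact current_liexx Y : current_lie Y Y = 0.
Proof.
apply/ffunP => k; rewrite !ffunE.
under eq_bigr => i _ do rewrite big_mkcond /=.
rewrite pair_bigA /= (bigID (fun p : 'I_r * 'I_r => p.1 < p.2)%N) /=.
rewrite [X in _ + X](bigID (fun p : 'I_r * 'I_r => p.1 == p.2)) /=.
rewrite [X in _ + (X + _)]big1 ?add0r; last first.
  by move=> [i j] /= /andP[_ /eqP ->]; rewrite liexx if_same.
pose sw (p : 'I_r * 'I_r) := (p.2, p.1).
have swK : involutive sw by case.
rewrite [X in _ + X](reindex_inj (inv_inj swK)) /=.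
apply/eqP; rewrite addr_eq0 -sumrN; apply/eqP.
apply: eq_big => [[i j] | [i j] _] /=.
  by rewrite -leqNgt ltn_neqAle andbC eq_sym.
by rewrite addnC; case: ifP => _; rewrite ?oppr0 -?lieC.
Qed.

Let current_lie3 X Y Z k : current_lie X (current_lie Y Z) k =
  \sum_(i < r) \sum_(j < r) \sum_(l < r | (i + j + l == k)%N)
    lie (X i) (lie (Y j) (Z l)).
Proof.
rewrite ffunE; apply: eq_bigr => i _.
under eq_bigr => b _ do rewrite ffunE linear_sum /=.
rewrite exchange_big /=; apply: eq_bigr => j _.
under eq_bigr => b _ do rewrite linear_sum /=.
rewrite (exchange_big_dep predT) //= [RHS]big_mkcond /=; apply: eq_bigr => l _.
case: ifP => [/eqP e | ne]; last first.
  by rewrite big_pred0 // => b; apply: contraFF ne => /andP[/eqP <- /eqP <-]; rewrite addnA.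
have jl : (j + l < r)%N by rewrite (leq_ltn_trans _ (ltn_ord k)) // -e -addnA leq_addl.
rewrite (big_pred1 (Ordinal jl)) // => b /=.
apply/andP/eqP => [[_ /eqP h] | ->]; first exact/val_inj.
by rewrite /= addnA e.
Qed.

Let addrE (Y Z : g_r) k : (Y + Z) k = Y k + Z k.
Proof. by rewrite ffunE. Qed.

Fact current_lie_jacobi X Y Z :
  current_lie X (current_lie Y Z) + current_lie Y (current_lie Z X)
    + current_lie Z (current_lie X Y) = 0.
Proof.
apply/ffunP => k; rewrite [RHS]ffunE 2!addrE.
rewrite !current_lie3.
have rot (f : 'I_r -> 'I_r -> 'I_r -> g) :
    \sum_(i < r) \sum_(j < r) \sum_(l < r) f i j l =
    \sum_(l < r) \sum_(i < r) \sum_(j < r) f i j l.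
  rewrite [RHS]exchange_big /=; apply: eq_bigr => i _; exact: exchange_big.
under eq_bigr => i _ do under eq_bigr => j _ do rewrite big_mkcond.
under [X in _ + X + _]eq_bigr => i _ do under eq_bigr => j _ do rewrite big_mkcond.
under [X in _ + _ + X]eq_bigr => i _ do under eq_bigr => j _ do rewrite big_mkcond.
rewrite [X in _ + X + _]rot [X in _ + _ + X]rot [X in _ + _ + X]rot.
rewrite -!big_split big1 //= => i _; rewrite -!big_split big1 //= => j _.
rewrite -!big_split big1 //= => l _.
have -> : (j + l + i = i + j + l)%N by rewrite addnC addnA.
have -> : (l + i + j = i + j + l)%N by rewrite -addnA addnC.
by case: ifP => _; rewrite ?addr0 // lie_jacobi.
Qed.

HB.instance Definition _ := isLieAlgebra.Build F g_r
  current_lie_is_linearl current_lie_is_linearr current_liexx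
  current_lie_jacobi.

(* X |-> X eps^i *)
Definition monomial (i : 'I_r) : 'Hom(g, g_r) :=
  linfun (fun x => [ffun j => if j == i then x else 0] : g_r).

(* \bigoplus_i (U i) eps^i *)
Definition graded (U : 'I_r -> {vspace g}) : {vspace g_r} :=
  (\sum_(i < r) (monomial i @: U i))%VS.

Lemma monomialE i x j : monomial i x j = if j == i then x else 0.
Proof.
have lin : linear (fun x => [ffun j => if j == i then x else 0] : g_r).
  move=> a u v; apply/ffunP => k; rewrite !ffunE.
  by case: ifP => _; rewrite ?scaler0 ?addr0.
pose h := GRing.isLinear.Build F g g_r *:%R _ lin.
pose H : {linear g -> g_r} :=
  HB.pack (fun x => [ffun j => if j == i then x else 0] : g_r) h.
by rewrite /monomial (lfunE H) ffunE.
Qed.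

Lemma current_sumE (I : finType) (f : I -> g_r) j :
  (\sum_i f i) j = \sum_i f i j.
Proof. by elim/big_rec2: _ => [|i u v _ <-]; rewrite ffunE. Qed.

Lemma gradedP (U : 'I_r -> {vspace g}) (Y : g_r) :
  reflect (forall i, Y i \in U i) (Y \in graded U).
Proof.
apply: (iffP memv_sumP) => [[u uU ->] j | YU].
  rewrite current_sumE; apply: memv_suml => i _.
  have /memv_imgP[x xU ->] := uU i isT.
  by rewrite monomialE; case: eqP => [->//|_]; exact: mem0v.
exists (fun i => monomial i (Y i)) => [i _|]; first exact: memv_img.
apply/ffunP => j; rewrite current_sumE (bigD1 j) //= monomialE eqxx big1 ?addr0 //.
by move=> i ij; rewrite monomialE eq_sym (negPf ij).
Qed.

End Current.

Section Filtration.
Context {F : fieldType} {g : lieAlgType F} (t : {vspace g}) (r : nat).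
Local Notation tdual := (dual (subvs_of t)).
Local Notation g_r := (current r g).
Implicit Types (psi phi : nat -> {fset tdual}) (lam : 'I_r -> tdual).

Definition levi phi : {vspace g_r} :=
  graded (fun i : 'I_r => t + \sum_(a <- phi i) root_space a)%VS.

Definition uplus psi : {vspace g_r} :=
  graded (fun i : 'I_r =>
    \sum_(a <- (psi i `\` levi_factor psi i)%fset) root_space a)%VS.

Definition uminus psi : {vspace g_r} :=
  graded (fun i : 'I_r =>
    \sum_(a <- (psi i `\` levi_factor psi i)%fset) root_space (- a))%VS.

Definition levi_proj psi : 'End(g_r) :=
  daddv_pi (levi (levi_factor psi)) (uminus psi + uplus psi)%VS.

(* The projection of g onto t along the sum of all root spaces. *)
Definition cartan_proj (x : g) : subvs_of t :=
  vsproj t (daddv_pi t (\sum_(a <- roots t) root_space a)%VS x).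

Definition extend lam : dual g_r :=
  linfun (fun Y : g_r => \sum_(i < r) lam i (cartan_proj (Y i)) : F^o).

Lemma extendE lam Y : extend lam Y = \sum_(i < r) lam i (cartan_proj (Y i)).
Proof.
have lin : linear (fun Y : g_r => \sum_(i < r) lam i (cartan_proj (Y i)) : F^o).
  move=> a u v; rewrite scaler_sumr -big_split; apply: eq_bigr => i _ /=.
  by rewrite !ffunE /cartan_proj !linearP.
pose h := GRing.isLinear.Build F g_r F^o *:%R _ lin.
pose H : {linear g_r -> F^o} :=
  HB.pack (fun Y : g_r => \sum_(i < r) lam i (cartan_proj (Y i)) : F^o) h.
by rewrite /extend (lfunE H).
Qed.

Definition in_Z phi lam : Prop :=
  forall (i : 'I_r) a, a \in phi i -> lam i (coroot a) = 0.

Definition in_stratum phi lam : Prop :=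
  in_Z phi lam /\
  forall (i : 'I_r) a, a \in (phi i.+1 `\` phi i)%fset -> lam i (coroot a) <> 0.

Definition levi_char psi lam (Y : subvs_of (levi (levi_factor psi))) : F :=
  extend lam (vsval Y).

Definition B_form psi lam (Y Y' : g_r) : F :=
  levi_char lam (vsproj (levi (levi_factor psi)) (levi_proj psi (lie Y Y'))).

Definition nilp_to_tangent psi lam
    (YY' : subvs_of (uplus psi) * subvs_of (uminus psi)) :
    subvs_of (orbit_tangent (extend lam)) :=
  to_tangent (extend lam) (vsval YY'.1 + vsval YY'.2).

Definition B_is_kks_restriction psi lam : Prop :=
  bijective (@nilp_to_tangent psi lam) /\
  forall (Y : subvs_of (uplus psi)) (Y' : subvs_of (uminus psi)),
    B_form psi lam (vsval Y) (vsval Y') =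
    kks (nilp_to_tangent lam (Y, 0)) (nilp_to_tangent lam (0, Y')).

End Filtration.

(* Main.v *)
Require Import Defs.
From mathcomp Require Import all_boot all_order all_algebra finmap complex.
From mathcomp Require Import boolp classical_sets cardinality reals.
From mathcomp Require Import ring.
Set Implicit Arguments.
Unset Strict Implicit.
Unset Printing Implicit Defensive.
Import Order.TTheory GRing.Theory Num.Theory.
Local Open Scope ring_scope.

(** Write [f] for [lam] extended to the current algebra, [u] for the sum of the
    two nilpotent parts, [l] for the Levi part. Everything is graded by the
    weights of [t] and by the powers of epsilon. Since [f] only sees the
    [t]-component, it pairs the root space of [a] in degree [i] with that of
    [b] in degree [j] trivially unless [b = - a], and in this case the bracket
    is a multiple of the coroot of [a], so that the value is a multiple of
    [lam (i + j)] at this coroot. Let [d a] be the first level at which [a]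
    enters the Levi filtration; the root space of [a] lies in [l] exactly in
    the degrees at least [d a]. The hypothesis on [lam] says that [lam k]
    vanishes at the coroot of [a] for all [k >= d a], whence [l] is contained
    in the stabiliser of [f] ([levi_sub_stab]). The stratum condition says
    that, moreover, [lam (d a - 1)] does not vanish there. If it holds, an
    [a]-component in degree [i < d a] is detected by pairing with degree
    [d a - 1 - i] ([stratum_stab_sub_levi]); if it fails for [a], the root
    space of [a] in degree [d a - 1] stabilises [f] without being in [l]
    ([stab_eq_levi_stratum]). Finally [f] vanishes on [u], so that the form B
    always is the restriction of the Kirillov-Kostant-Souriau form
    ([B_formE]); the first condition then means that [u], a complement of [l],
    is a complement of the stabiliser, that is, that the stabiliser is [l]
    ([B_kks_stab_eq_levi], [stab_eq_levi_B_kks]).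

    The pairing used above rests on the classical facts that [g] is the direct
    sum of [t] and of its root spaces, that these are lines, and that opposite
    root spaces have as bracket the line of a coroot. The first one is
    simultaneous diagonalisation ([weight_sum]). For the others it suffices to
    find in opposite root spaces [e] and [f] such that [a] does not vanish at
    [[e, f]]: an sl2 computation then shows that the root space is the line of
    [e] ([weight_space_line]). A root for which there is no such pair is called
    nilpotent below. Brackets of opposite root vectors are central for a
    nilpotent root, so that its root space is in the radical of the Killing
    form, whereas the Killing form pairs nontrivially the members [e], [f] of
    an sl2-triple. It follows that the centre and the root spaces of all
    nilpotent roots together form an ideal ([nilradical_ideal]). A version of
    Engel's theorem for subalgebras stable under [t] shows that this ideal is
    solvable ([nilradical_solvable]). Reductivity makes it central, and a root
    vector is not central, so there are no nilpotent roots
    ([root_not_nilpotent]). *)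

(** * Sums of eigenvectors *)

Section EigenvectorSums.
Context {F : fieldType} {V : vectType F}.

(** Subtracting from the action of an operator its eigenvalue on one of the
    summands kills this summand and rescales the others by nonzero factors as
    soon as the operator separates the weights; induct on the number of
    summands. With [M] zero this is the independence of eigenvectors; with [M]
    stable under the Cartan subalgebra it says that [M] is graded by weights.
    The abstract index type [A] covers both the eigenvalues of one operator and
    linear forms on a space of operators. *)
Lemma eigen_sum_mem (T : Type) (A : eqType) (phi : T -> 'End(V))
    (wt : A -> T -> F) (M : {vspace V}) (s : seq A) (v : A -> V) :
  (forall a b, a != b -> exists h, wt a h != wt b h) ->
  (forall h x, x \in M -> phi h x \in M) ->
  (forall a h, phi h (v a) = wt a h *: v a) ->
  uniq s -> \sum_(a <- s) v a \in M -> {in s, forall a, v a \in M}.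
Proof.
move=> sep phiM; elim: s v => [//|b s IH] v vE /= /andP[bs us].
rewrite big_cons => vM.
have vs a : a \in s -> v a \in M.
  move=> as_; have /sep[h neh] : a != b by apply: contraNneq bs => <-.
  pose w c := (wt c h - wt b h) *: v c.
  suff : w a \in M by rewrite rpredZeq subr_eq0 (negPf neh).
  apply: (IH w) => // [c k|]; first by rewrite linearZ /= vE !scalerA mulrC.
  have -> : \sum_(c <- s) w c =
      phi h (v b + \sum_(c <- s) v c) - wt b h *: (v b + \sum_(c <- s) v c).
    rewrite linearD linear_sum /= vE scalerDr opprD addrACA subrr add0r.
    rewrite scaler_sumr -sumrB.
    by apply: eq_bigr => c _; rewrite vE /w scalerBl.
  by rewrite rpredB ?rpredZ ?phiM.
move=> a; rewrite inE => /predU1P[->|/vs//].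
by move: vM; rewrite rpredDr // big_seq; apply: rpred_sum.
Qed.

Lemma memv_sum_seqP (A : eqType) (s : seq A) (U : A -> {vspace V}) x :
  uniq s -> x \in (\sum_(a <- s) U a)%VS ->
  exists2 v : A -> V, forall a, v a \in U a & x = \sum_(a <- s) v a.
Proof.
elim: s x => [|b s IH] x /=.
  move=> _; rewrite big_nil memv0 => /eqP ->.
  by exists (fun=> 0) => [a|]; rewrite ?mem0v ?big_nil.
move=> /andP[bs us]; rewrite big_cons => /memv_addP[y yb [z /(IH _ us)[v vU ->] ->]].
exists (fun a => if a == b then y else v a) => [a|].
  by case: eqP => // ->.
rewrite big_cons eqxx; congr (_ + _); apply: eq_big_seq => a as_.
by case: eqP as_ bs => // -> ->.
Qed.

Lemma memv_sum_seq (A : eqType) (s : seq A) (U : A -> {vspace V}) a x :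
  a \in s -> x \in U a -> x \in (\sum_(b <- s) U b)%VS.
Proof.
elim: s => [//|b s IH]; rewrite inE big_cons => /predU1P[<- xU|as_ xU].
  by rewrite -[x]addr0 memv_add ?mem0v.
by rewrite -[x]add0r memv_add ?mem0v ?IH.
Qed.

Lemma memv_add_line (U : {vspace V}) x : x \in (U + <[x]>)%VS.
Proof. exact: subvP (addvSr U _) x (memv_line x). Qed.

(** How nilpotency of [phi] is used below: with [M] zero it produces lowest or
    highest weight vectors, and in the Engel argument it produces a vector
    killed by [phi] modulo [M]. *)
Lemma last_iterate_outside (phi : V -> V) (M : {vspace V}) k x :
  x \notin M -> iter k phi x \in M ->
  exists j, iter j phi x \notin M /\ phi (iter j phi x) \in M.
Proof.
elim: k => [|k IH] xM; first by move=> /= /[!(negPf xM)].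
by have [/(IH xM)|kM] := boolP (iter k phi x \in M); last by exists k.
Qed.

End EigenvectorSums.

(** * Brackets and transporters *)

Section LieBasics.
Context {F : fieldType} {L : lieAlgType F}.
Implicit Types (x y z : L) (U W M N : {vspace L}).

Lemma lieDr x y z : lie x (y + z) = lie x y + lie x z.
Proof. exact: linearD. Qed.
Lemma lieBr x y z : lie x (y - z) = lie x y - lie x z.
Proof. exact: linearB. Qed.
Lemma lieNr x y : lie x (- y) = - lie x y.
Proof. exact: linearN. Qed.
Lemma lieZr a x y : lie x (a *: y) = a *: lie x y.
Proof. exact: linearZ. Qed.
Lemma lie0r x : lie x 0 = 0.
Proof. exact: linear0. Qed.
Lemma lie_sumr (I : Type) (s : seq I) (P : pred I) x (v : I -> L) :
  lie x (\sum_(i <- s | P i) v i) = \sum_(i <- s | P i) lie x (v i).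
Proof. exact: linear_sum. Qed.
Lemma lieDl x y z : lie (x + y) z = lie x z + lie y z.
Proof. exact: (linearD (lier z)). Qed.
Lemma lieZl a x y : lie (a *: x) y = a *: lie x y.
Proof. exact: (linearZ_LR (lier y)). Qed.
Lemma lie0l x : lie 0 x = 0.
Proof. exact: (linear0 (lier x)). Qed.
Lemma lie_suml (I : Type) (s : seq I) (P : pred I) x (v : I -> L) :
  lie (\sum_(i <- s | P i) v i) x = \sum_(i <- s | P i) lie (v i) x.
Proof. exact: (linear_sum (lier x)). Qed.

Lemma lie_derivation x y z :
  lie x (lie y z) = lie (lie x y) z + lie y (lie x z).
Proof.
have := lie_jacobi x y z.
rewrite (lieC (lie x y) z) (lieC x z) lieNr.
by move/eqP; rewrite subr_eq0 subr_eq => /eqP.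
Qed.

Lemma lie_lie x y z : lie (lie x y) z = lie x (lie y z) - lie y (lie x z).
Proof. by rewrite lie_derivation addrK. Qed.

(** The elements that [N] sends into [W]; a basis of [N] is used so as to have
    a finite intersection of subspaces. *)
Definition transporter N W : {vspace L} :=
  (\bigcap_(y <- vbasis N) (ad y @^-1: W))%VS.

Lemma transporterP N W x :
  reflect (forall y, y \in N -> lie y x \in W) (x \in transporter N W).
Proof.
have -> : (x \in transporter N W) = all (fun y => lie y x \in W) (vbasis N).
  rewrite /transporter; elim: (tval _) => [|h s IH].
    by rewrite big_nil memvf.
  by rewrite big_cons memv_cap IH /= -memv_preim adE.
apply: (iffP allP) => [xW y /coord_vbasis -> | xW y /vbasis_mem]; last exact: xW.
rewrite lie_suml rpred_sum // => i _; rewrite lieZl rpredZ ?xW //.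
by rewrite mem_nth ?size_tuple.
Qed.

Definition center : {vspace L} := transporter fullv 0%VS.

Lemma centerP x : reflect (forall y, lie y x = 0) (x \in center).
Proof.
apply: (iffP (transporterP _ _ _)) => [h y | h y _].
  by apply/eqP; rewrite -memv0 h ?memvf.
by rewrite h mem0v.
Qed.

Lemma center_lier x y : x \in center -> lie x y = 0.
Proof. by move/centerP => h; rewrite lieC h oppr0. Qed.

Lemma lie_prod_subv U W M : (forall x y, x \in U -> y \in W -> lie x y \in M) ->
  (lie_prod U W <= M)%VS.
Proof.
move=> h; apply/span_subvP => z /allpairsP[[x y] /= [xU yW ->]].
by rewrite h // vbasis_mem.
Qed.

End LieBasics.
Arguments center {F} L.

(** * Rank-one computations and the Killing form *)

Section AdSemisimple.
Context {F : numFieldType} {L : lieAlgType F}.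
Implicit Types (e f h u v w x y z : L) (m s : F).

Definition eigenbasis h n (X : n.-tuple L) (mu : 'I_n -> F) : Prop :=
  basis_of fullv X /\ forall i : 'I_n, lie h X`_i = mu i *: X`_i.

Lemma ad_semisimple_eigenbasis h : ad_semisimple h ->
  exists n, exists X : n.-tuple L, exists mu, eigenbasis h X mu.
Proof.
case=> b bb bE; exists (size b), (in_tuple b).
have /fin_all_exists[mu muE] : forall i : 'I_(size b), exists c,
    lie h b`_i = c *: b`_i.
  by move=> i; have [c] := bE b`_i (mem_nth _ (ltn_ord i)); rewrite adE; exists c.
by exists mu.
Qed.

Lemma eigenbasis_eigenvalue h n (X : n.-tuple L) mu w m :
  eigenbasis h X mu -> w != 0 -> lie h w = m *: w -> exists i, mu i = m.
Proof.
move=> [Xb XE] w0 wE.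
have wX := coord_basis Xb (memvf w).
have [i ci] : exists i, coord X i w != 0.
  apply/existsP; apply: contraNT w0; rewrite negb_exists => /forallP c0.
  rewrite wX big1 // => i _; have := c0 i.
  by rewrite negbK => /eqP ->; rewrite scale0r.
exists i; have := congr1 (coord X i) wE.
rewrite {1}wX lie_sumr linear_sum /= (bigD1 i) //= big1 => [|j ji].
  rewrite lieZr XE !linearZ /= coord_free ?(basis_free Xb) // eqxx.
  by rewrite addr0 mulr1 mulrC => /(mulIf ci).
rewrite lieZr XE !linearZ /= coord_free ?(basis_free Xb) //.
by rewrite (negPf ji) !mulr0.
Qed.

Lemma iter_lie0 e k : iter k (lie e) 0 = 0.
Proof. by elim: k => //= k ->; rewrite lie0r. Qed.

Lemma iter_lie_weight h e w s m k : lie h e = s *: e -> lie h w = m *: w ->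
  lie h (iter k (lie e) w) = (m + k%:R * s) *: iter k (lie e) w.
Proof.
move=> he hw; elim: k => [|k IH]; first by rewrite mul0r addr0.
rewrite iterS lie_derivation IH he lieZl lieZr -scalerDl -natr1.
by rewrite mulrDl mul1r addrC addrA.
Qed.

Definition ad_locally_nilpotent e : Prop :=
  forall v, exists k, iter k (lie e) v = 0.

(** [e] shifts the eigenvalues of [ad h] by [s], and the [n + 1] numbers
    [mu i + j s] cannot all be among the [n] eigenvalues of [ad h]. *)
Lemma ad_nilpotent_of_weight h e s : ad_semisimple h -> s != 0 ->
  lie h e = s *: e -> ad_locally_nilpotent e.
Proof.
move=> /ad_semisimple_eigenbasis[n [X [mu hX]]] s0 he v; exists n.
have Xn (i : 'I_n) : iter n (lie e) X`_i = 0.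
  have := hX.2 i; move: X`_i => w hw.
  have [//|nz] := eqVneq (iter n (lie e) w) 0; exfalso.
  have /fin_all_exists[p pE] : forall j : 'I_n.+1, exists k, mu k = mu i + j%:R * s.
    move=> j; apply: (eigenbasis_eigenvalue hX (w := iter j (lie e) w)).
      apply: contraNneq nz => j0.
      by rewrite -(subnK (ltnSE (ltn_ord j))) iterD j0 iter_lie0.
    exact: iter_lie_weight he hw.
  have /leq_card : injective p.
    move=> j k pjk; have := pE j; rewrite pjk pE => /addrI/(mulIf s0)/eqP.
    by rewrite eqr_nat => /eqP/esym/val_inj.
  by rewrite !card_ord ltnn.
rewrite (coord_basis hX.1 (memvf v)).
have -> k (c : 'I_n -> F) : iter k (lie e) (\sum_i c i *: X`_i) =
    \sum_i c i *: iter k (lie e) X`_i.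
  by elim: k => //= k ->; rewrite lie_sumr; apply: eq_bigr => i _; rewrite lieZr.
by rewrite big1 // => i _; rewrite Xn scaler0.
Qed.

(** Commuting [f] past one more [e] costs a bracket with [h = [e, f]], whose
    eigenvalue on the [k]-th vector is [m + k s]; the coefficient is minus the sum of
    these eigenvalues. The value [s = 0] is allowed, and so is a nonzero
    [[f, w]], provided that [e] kills it. *)
Lemma sl2_lowering e f w s m k :
  lie (lie e f) e = s *: e -> lie (lie e f) w = m *: w ->
  lie e (lie f w) = 0 ->
  lie f (iter k.+1 (lie e) w) =
    - (k.+1%:R * m + 'C(k.+1, 2)%:R * s) *: iter k (lie e) w.
Proof.
move=> he hw efw.
have step z : lie f (lie e z) = lie e (lie f z) - lie (lie e f) z.
  by rewrite lie_lie opprB addrCA subrr addr0.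
elim: k => [|k IH]; first by rewrite /= step hw efw bin_small // mul1r mul0r addr0 sub0r scaleNr.
rewrite iterS step IH lieZr -/(iter k.+1 (lie e) w).
rewrite (iter_lie_weight _ he hw) -scalerBl -opprD; congr (- _ *: _).
by rewrite ['C(k.+2, 2)]binS bin1 natrD -[k.+2%:R]natr1; ring.
Qed.

(** Apply [f] to [v] until the last nonzero vector [w], of eigenvalue
    [mu - j s], then [e] to [w] until the last nonzero vector, the [i]-th. The
    coefficient of [sl2_lowering] at that point must vanish, which reads
    [2 (mu - j s) + i s = 0]. Hence the eigenvalues of [ad [e, f]] are half
    integral multiples of [s]; in particular they all vanish when [s = 0]. *)
Lemma ad_bracket_eigenvalue e f s mu v :
  ad_locally_nilpotent e -> ad_locally_nilpotent f ->
  lie (lie e f) e = s *: e -> lie (lie e f) f = - s *: f ->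
  lie (lie e f) v = mu *: v -> v != 0 ->
  exists n : int, mu *+ 2 = n%:~R * s.
Proof.
move=> ne nf he hf hv v0.
have nz x : (x == 0) = (x \in 0%VS) by rewrite memv0.
have [k fk] := nf v.
have vn : v \notin 0%VS by rewrite -nz.
have fk0 : iter k (lie f) v \in 0%VS by rewrite fk mem0v.
have [j [wn]] := last_iterate_outside vn fk0.
set w := iter j (lie f) v in wn *; rewrite memv0 => /eqP fw.
have hw := iter_lie_weight j hf hv; rewrite -/w in hw.
have [k' ek] := ne w.
have ek0 : iter k' (lie e) w \in 0%VS by rewrite ek mem0v.
have [i []] := last_iterate_outside wn ek0.
rewrite !memv0 => win /eqP ei.
have := @sl2_lowering e f w s _ i he hw; rewrite fw lie0r => /(_ erefl).
rewrite iterS ei lie0r => /esym/eqP.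
rewrite scaler_eq0 (negPf win) orbF oppr_eq0 => /eqP E.
exists ((j * 2)%N%:Z - i%:Z).
have i0 : i.+1%:R != 0 :> F by rewrite pnatr_eq0.
have C2 : i.+1%:R * i%:R = 'C(i.+1, 2)%:R *+ 2 :> F.
  by rewrite -mulrnA -natrM; congr _%:R; rewrite [RHS]mulnC -mul_bin_diag bin1.
rewrite intrB -!pmulrn natrM.
(* Double [E] to turn the binomial coefficient into a product. *)
apply: (mulfI i0); apply/eqP; rewrite -subr_eq0; apply/eqP.
set A := i.+1%:R in E C2 *; set D := 'C(_, _)%:R in E C2.
have -> : A * (mu *+ 2) - A * ((j%:R * 2 - i%:R) * s) =
    (A * (mu + j%:R * - s) + D * s) *+ 2 + (A * i%:R - D *+ 2) * s by ring.
by rewrite E C2 subrr mul0r mul0rn addr0.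
Qed.
Lemma ad_bracket_central e f :
  ad_locally_nilpotent e -> ad_locally_nilpotent f ->
  ad_semisimple (lie e f) -> lie (lie e f) e = 0 -> lie (lie e f) f = 0 ->
  lie e f \in center L.
Proof.
move=> ne nf /ad_semisimple_eigenbasis[n [X [mu [Xb XE]]]] he hf.
apply/centerP => y; rewrite lieC (coord_basis Xb (memvf y)) lie_sumr.
rewrite big1 ?oppr0 // => i _; rewrite lieZr XE.
have [||||k] := @ad_bracket_eigenvalue e f 0 (mu i) X`_i ne nf.
- by rewrite scale0r.
- by rewrite oppr0 scale0r.
- exact: XE.
- by apply: (basis_not0 Xb); rewrite mem_nth ?size_tuple.
rewrite mulr0 => /eqP; rewrite mulrn_eq0 /= => /eqP ->.
by rewrite scale0r scaler0.
Qed.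

(** The matrix acts on row vectors, so that products are reversed with respect
    to composition. *)
Definition ad_mx n (X : n.-tuple L) x : 'M[F]_n :=
  \matrix_(i, j) coord X j (lie x X`_i).

Definition killing n (X : n.-tuple L) x y : F :=
  \tr (ad_mx X x *m ad_mx X y).

Section Killing.
Variables (n : nat) (X : n.-tuple L).
Hypothesis Xb : basis_of fullv X.

Lemma ad_mxZ c x : ad_mx X (c *: x) = c *: ad_mx X x.
Proof. by apply/matrixP => i j; rewrite !mxE lieZl linearZ. Qed.

Lemma ad_mx_lie x y :
  ad_mx X (lie x y) = ad_mx X y *m ad_mx X x - ad_mx X x *m ad_mx X y.
Proof.
have adM u v i j : (ad_mx X u *m ad_mx X v) i j = coord X j (lie v (lie u X`_i)).
  rewrite mxE [lie u _ in RHS](coord_basis Xb (memvf _)) lie_sumr linear_sum.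
  by apply: eq_bigr => k _; rewrite !mxE lieZr linearZ.
by apply/matrixP => i j; rewrite [RHS]mxE [X in _ + X]mxE !adM mxE lie_lie linearB.
Qed.

Lemma killing_assoc x y z : killing X (lie x y) z = killing X x (lie y z).
Proof.
rewrite /killing !ad_mx_lie mulmxBl mulmxBr !linearB /=.
rewrite !mulmxA; congr (_ - _).
by rewrite -[in LHS]mulmxA mxtrace_mulC.
Qed.

Lemma killingZl c x y : killing X (c *: x) y = c * killing X x y.
Proof. by rewrite /killing ad_mxZ -scalemxAl mxtraceZ. Qed.

Lemma killingZr c x y : killing X x (c *: y) = c * killing X x y.
Proof. by rewrite /killing ad_mxZ -scalemxAr mxtraceZ. Qed.

Lemma killing_central x z : z \in center L -> killing X x z = 0.
Proof.
move=> zc; have -> : z = (0 : F) *: z + z by rewrite scale0r add0r.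
rewrite /killing; suff -> : ad_mx X (0 *: z + z) = 0 by rewrite mulmx0 mxtrace0.
by apply/matrixP => i j; rewrite !mxE scale0r add0r center_lier // linear0.
Qed.

Lemma killing_diag h mu : eigenbasis h X mu ->
  killing X h h = \sum_i mu i ^+ 2.
Proof.
move=> [_ XE]; apply: eq_bigr => i _; rewrite mxE (bigD1 i) //= big1 => [|j ji].
  by rewrite !mxE XE linearZ /= coord_free ?(basis_free Xb) // eqxx mulr1 addr0.
by rewrite !mxE !XE !linearZ /= !coord_free ?(basis_free Xb) // (negPf ji) !mulr0.
Qed.

End Killing.

(** In an eigenbasis of [h = [e, f]] the value is the sum of the squares of the
    eigenvalues. By [ad_bracket_eigenvalue] it is [(s / 2)^2] times a sum of
    squares of integers, not all zero because [s] itself is an eigenvalue, with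
    eigenvector [e]. *)
Lemma killing_sl2_neq0 e f s n (X : n.-tuple L) mu :
  ad_locally_nilpotent e -> ad_locally_nilpotent f -> s != 0 -> e != 0 ->
  lie (lie e f) e = s *: e -> lie (lie e f) f = - s *: f ->
  eigenbasis (lie e f) X mu -> killing X (lie e f) (lie e f) != 0.
Proof.
move=> ne nf s0 e0 he hf hX; have Xb := hX.1; rewrite (killing_diag Xb hX).
have /fin_all_exists[k kE] : forall i, exists k : int, mu i *+ 2 = k%:~R * s.
  move=> i; apply: (ad_bracket_eigenvalue ne nf he hf (hX.2 i)).
  by apply: (basis_not0 Xb); rewrite mem_nth ?size_tuple.
have {}kE i : mu i = (k i)%:~R * (s / 2).
  by apply: (mulIf (x := 2)); rewrite ?pnatr_eq0 // mulr_natr kE; field.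
have -> : \sum_i mu i ^+ 2 = (\sum_i k i ^+ 2)%:~R * (s / 2) ^+ 2.
  rewrite rmorph_sum mulr_suml; apply: eq_bigr => i _.
  by rewrite kE exprMn rmorphXn.
rewrite mulf_neq0 ?expf_neq0 ?mulf_neq0 ?invr_eq0 ?pnatr_eq0 // intr_eq0.
have [i mui] := eigenbasis_eigenvalue hX e0 he.
rewrite psumr_eq0 => [|j _]; last exact: sqr_ge0.
apply/allPn; exists i; first exact: mem_index_enum.
by apply: contraNneq s0 => /= /eqP; rewrite sqrf_eq0 -mui kE => /eqP ->; rewrite mul0r.
Qed.

(** A nonzero [w] would generate an infinite string of nonzero vectors, since
    the coefficients of [sl2_lowering] are [s] times positive integers, against
    the nilpotency of [e]. *)
Lemma lowest_weight_eq0 e f s w : ad_locally_nilpotent e -> s != 0 ->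
  lie (lie e f) e = s *: e -> lie (lie e f) w = s *: w ->
  lie e (lie f w) = 0 -> w = 0.
Proof.
move=> ne s0 he hw efw; apply/eqP; rewrite -memv0; apply: contraT => wn.
have [k ek] := ne w.
have ek0 : iter k (lie e) w \in 0%VS by rewrite ek mem0v.
have [i []] := last_iterate_outside wn ek0.
rewrite !memv0 => win /eqP ei.
have := sl2_lowering i he hw efw; rewrite iterS ei lie0r => /esym/eqP.
rewrite scaler_eq0 (negPf win) orbF oppr_eq0 -mulrDl -natrD.
by rewrite mulf_eq0 (negPf s0) orbF pnatr_eq0.
Qed.

(** The combination [x + (u / s) e] is chosen so that [e] kills its bracket with
    [f]; then [lowest_weight_eq0] applies to it. *)
Lemma weight_space_line e f x s (u : F) : ad_locally_nilpotent e -> s != 0 ->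
  lie (lie e f) e = s *: e -> lie (lie e f) x = s *: x ->
  lie (lie f x) e = u *: e -> exists c, x = c *: e.
Proof.
move=> ne s0 he hx fxe; exists (- (u / s)).
apply/eqP; rewrite -subr_eq0; apply/eqP; apply: (lowest_weight_eq0 ne s0 he).
  by rewrite lieBr lieZr he hx !scalerBr !scalerA mulrC.
rewrite lieBr lieZr lieBr lieZr (lieC (lie f x)) fxe (lieC e f) lieNr.
rewrite (lieC (lie e f)) he opprK scalerA mulNr divfK //.
by rewrite scaleNr opprK addNr.
Qed.

End AdSemisimple.

(** * The root space decomposition *)

Section RootDecomposition.
Context {F : numFieldType} {L : lieAlgType F} (t : {vspace L}).
Hypothesis tC : cartan_subalgebra t.
Local Notation roots := Defs.roots.
Local Notation tdual := (dual (subvs_of t)).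
Implicit Types (a b : tdual) (x y z h v w : L).

Lemma root_spaceE a x h : x \in root_space a -> h \in t ->
  lie h x = (a (vsproj t h) : F) *: x.
Proof. by move=> /root_spaceP xa ht; rewrite -xa vsprojK. Qed.

Lemma root_space_lie a b x y : x \in root_space a -> y \in root_space b ->
  lie x y \in root_space (a + b).
Proof.
move=> /root_spaceP xa /root_spaceP yb; apply/root_spaceP => h.
by rewrite lie_derivation xa yb lieZl lieZr -scalerDl add_lfunE.
Qed.

(** This is where maximality of the Cartan subalgebra is used: a vector that
    commutes with [t] can be added to it. *)
Lemma root_space0 : root_space (0 : tdual) = t.
Proof.
have [tt tmax _] := tC; apply/eqP; rewrite eqEsubv; apply/andP; split; last first.
  apply/subvP => x xt; apply/root_spaceP => h.
  by rewrite zero_lfunE scale0r tt ?subvsP.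
apply/subvP => x /root_spaceP x0.
have tx h : h \in t -> lie h x = 0.
  by move=> ht; rewrite -(vsprojK ht) x0 zero_lfunE scale0r.
suff tx_abelian : lie_commutative (t + <[x]>)%VS.
  rewrite -[in X in _ \in X](tmax _ (addvSl _ _) tx_abelian).
  exact: memv_add_line.
move=> y z /memv_addP[y1 y1t [_ /vlineP[c ->] ->]].
move=> /memv_addP[z1 z1t [_ /vlineP[d ->] ->]].
rewrite lieDr !lieDl !lieZr !lieZl (tx _ y1t) liexx (lieC z1 x) (tx _ z1t) (tt _ _ y1t z1t).
by rewrite oppr0 !scaler0 !add0r.
Qed.

Lemma cartan_semisimple h : h \in t -> ad_semisimple h.
Proof. by have [_ _] := tC; apply. Qed.

Lemma cartan_commutes h k : h \in t -> k \in t -> lie h k = 0.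
Proof. by have [+ _ _] := tC; apply. Qed.

Let joint_eigen (hs : seq L) w := forall h, h \in hs -> exists c : F, lie h w = c *: w.

(** Simultaneous diagonalisation, one operator at a time. The components of a
    joint eigenvector [w] for one more semisimple element [h] stay in the
    eigenspaces that contain [w], because these are stable under [ad h]. *)
Lemma joint_eigen_sum (hs : seq L) v : {subset hs <= t} ->
  exists2 vs : seq L, v = \sum_(w <- vs) w & forall w, w \in vs -> joint_eigen hs w.
Proof.
elim: hs v => [|h hs IH] v hst.
  by exists [:: v] => [|w _ //]; rewrite big_seq1.
have ht : h \in t by rewrite hst ?mem_head.
have hst' : {subset hs <= t} by move=> k kh; rewrite hst // inE kh orbT.
have [vs -> {v}] := IH v hst'; elim: vs => [|w vs IHvs] vsJ.
  by exists [::]; rewrite ?big_nil.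
have [us usE usJ] := IHvs (fun u uv => vsJ u (mem_behead (s := w :: vs) uv)).
suff [ws wsE wsJ] : exists2 ws : seq L, w = \sum_(u <- ws) u &
    forall u, u \in ws -> joint_eigen (h :: hs) u.
  exists (ws ++ us); first by rewrite big_cons big_cat -wsE -usE.
  by move=> u; rewrite mem_cat => /orP[/wsJ|/usJ].
have [n [X [mu [Xb XE]]]] := ad_semisimple_eigenbasis (cartan_semisimple ht).
pose c i := coord X i w.
pose u m := \sum_(i < n | mu i == m) c i *: X`_i.
pose s := undup [seq mu i | i <- enum 'I_n].
have uE m : lie h (u m) = m *: u m.
  rewrite lie_sumr scaler_sumr; apply: eq_bigr => i /eqP <-.
  by rewrite lieZr XE !scalerA mulrC.
have wE : w = \sum_(m <- s) u m.
  rewrite {1}(coord_basis Xb (memvf w)) /u (exchange_big_dep xpredT) //=.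
  apply: eq_bigr => i _.
  have mus : mu i \in s by rewrite mem_undup map_f ?mem_enum.
  rewrite big_mkcond (bigD1_seq _ mus) ?undup_uniq //= eqxx big1 ?addr0 // => m.
  by rewrite eq_sym => /negPf ->.
exists [seq u m | m <- s]; first by rewrite big_map.
move=> _ /mapP[m ms ->] k; rewrite inE => /predU1P[->|kh]; first by exists m.
have [d dE] := vsJ w (mem_head _ _) k kh; exists d.
(* The [d]-eigenspace of [ad k], in which the components of [w] must stay. *)
pose M : {vspace L} := lker (ad k - d *: \1%VF).
have MP x : (x \in M) = (lie k x == d *: x).
  by rewrite memv_ker add_lfunE opp_lfunE scale_lfunE id_lfunE adE subr_eq0.
apply/eqP; rewrite -MP.
apply: (eigen_sum_mem (T := unit) (phi := fun=> ad h) (wt := fun m _ => m) (s := s)) => //.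
- move=> _ x; rewrite !MP adE lie_derivation => /eqP ->.
  by rewrite (cartan_commutes (hst' _ kh) ht) lie0l add0r lieZr.
- by move=> p _; rewrite adE uE.
- exact: undup_uniq.
- by rewrite -wE MP dE.
Qed.

Definition weights : seq tdual := 0 :: roots t.

Lemma uniq_weights : uniq weights.
Proof.
rewrite /= fset_uniq andbT; apply/negP.
by rewrite -[_ \in _]/(0 \in roots t) in_roots /is_root eqxx.
Qed.

Lemma root_space_eq0 a x : a \notin weights -> x \in root_space a -> x = 0.
Proof.
rewrite inE -[_ \in enum_fset _]/(a \in roots t) in_roots /is_root.
rewrite negb_or negb_and !negbK => /andP[/negPf -> /=].
by move=> /eqP ->; rewrite memv0 => /eqP.
Qed.

(** The weight is read off from a linear form that is [1] on [x]; composed with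
    the action on [x] it is linear in [h]. *)
Lemma joint_eigen_root_space x : x != 0 ->
  joint_eigen (vbasis t) x -> exists a, x \in root_space a.
Proof.
move=> x0 xJ.
have xJt h : h \in t -> exists c : F, lie h x = c *: x.
  move=> /coord_vbasis ->; elim/big_ind: _ => [|h1 h2 [c hc] [d kd]|i _].
  - by exists 0; rewrite lie0l scale0r.
  - by exists (c + d); rewrite lieDl hc kd scalerDl.
  - have [|c hc] := xJ (vbasis t)`_i; first by rewrite mem_nth ?size_tuple.
    by exists (coord (vbasis t) i h * c); rewrite lieZl hc scalerA.
pose X := [tuple x].
have Xf : free X by rewrite seq1_free.
pose l : {linear subvs_of t -> F^o} :=
  (coord X ord0 : {linear L -> F^o}) \o lier x \o vsval.
exists (linfun l).
apply/root_spaceP => h; rewrite lfunE /= /lier.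
have [c ->] := xJt _ (subvsP h); congr (_ *: _).
by rewrite linearZ /= -[X in coord _ _ X]/(X`_(ord0 : 'I_1)) coord_free // mulr1.
Qed.

Lemma weight_sum x : exists2 v : tdual -> L,
  forall a, v a \in root_space a & x = \sum_(a <- weights) v a.
Proof.
apply: memv_sum_seqP; first exact: uniq_weights.
have [|vs -> vsJ] := @joint_eigen_sum (vbasis t) x; first by move=> h; exact: vbasis_mem.
rewrite [X in X \in _]big_seq; apply: rpred_sum => w wvs; have wJ := vsJ w wvs.
have [->|w0] := eqVneq w 0; first exact: mem0v.
have [a wa] := joint_eigen_root_space w0 wJ.
apply: (memv_sum_seq _ wa); apply: contraR w0 => aw.
by apply/eqP; exact: root_space_eq0 aw wa.
Qed.

Lemma weight_components (M : {vspace L}) (s : seq tdual) (v : tdual -> L) :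
  (forall h x, h \in t -> x \in M -> lie h x \in M) ->
  (forall a, v a \in root_space a) ->
  uniq s -> \sum_(a <- s) v a \in M -> {in s, forall a, v a \in M}.
Proof.
move=> Mt va; apply: (@eigen_sum_mem _ _ (subvs_of t) _ (fun h : subvs_of t => ad (vsval h))
  (fun a (h : subvs_of t) => (a h : F))).
- by move=> a b /lfunPn[h ab]; exists h.
- by move=> h x xM; rewrite adE Mt ?subvsP.
- by move=> a h; rewrite adE; apply/root_spaceP.
Qed.

Lemma root_ad_nilpotent a x : a != 0 -> x \in root_space a ->
  ad_locally_nilpotent x.
Proof.
move=> /lfunPn[h]; rewrite zero_lfunE => ah /root_spaceP xa.
exact: (ad_nilpotent_of_weight (cartan_semisimple (subvsP h)) ah (xa h)).
Qed.

Lemma root_neq0 a : a \in roots t -> a != 0.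
Proof. by rewrite in_roots => /andP[]. Qed.

Lemma lie_root_opp a x y : x \in root_space a -> y \in root_space (- a) ->
  lie x y \in t.
Proof. by move=> xa ya; rewrite -root_space0 -(subrr a) root_space_lie. Qed.

End RootDecomposition.

(** * Reductive Lie algebras have no nilpotent roots *)

Section NilpotentRoots.
Context {F : numFieldType} {L : lieAlgType F} (t : {vspace L}).
Hypothesis tC : cartan_subalgebra t.
Local Notation roots := Defs.roots.
Local Notation tdual := (dual (subvs_of t)).
Implicit Types (a b : tdual) (x y z h v w : L).

Lemma root_bracket_e a x y w : x \in root_space a -> y \in root_space (- a) ->
  w \in root_space a -> lie (lie x y) w = (a (vsproj t (lie x y)) : F) *: w.
Proof. by move=> xa ya wa; rewrite -(root_spaceE wa) // (lie_root_opp tC xa). Qed.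

Lemma root_bracket_f a x y w : x \in root_space a -> y \in root_space (- a) ->
  w \in root_space (- a) ->
  lie (lie x y) w = - (a (vsproj t (lie x y)) : F) *: w.
Proof.
move=> xa ya wa; rewrite (root_spaceE wa) ?(lie_root_opp tC xa) //.
by rewrite opp_lfunE.
Qed.

(** The coroot of [a] does not exist exactly when this holds: it is then
    impossible to scale an element of [[g_a, g_(-a)]] to take the value [2] on
    [a]. *)
Definition nilpotent_root a : Prop :=
  forall x y, x \in root_space a -> y \in root_space (- a) ->
  (a (vsproj t (lie x y)) : F) = 0.

(** Here [h = [x, y]] commutes with [x] and [y], so by the case [s = 0] of
    [ad_bracket_eigenvalue] the semisimple operator [ad h] has no nonzero
    eigenvalue. *)
Lemma nilpotent_root_central a x y : a != 0 -> nilpotent_root a ->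
  x \in root_space a -> y \in root_space (- a) -> lie x y \in center L.
Proof.
move=> a0 na xa ya; apply: ad_bracket_central.
- exact: root_ad_nilpotent xa.
- by apply: root_ad_nilpotent ya; rewrite ?oppr_eq0.
- exact/(cartan_semisimple tC)/(lie_root_opp tC xa).
- by rewrite (root_bracket_e xa ya xa) na // scale0r.
- by rewrite (root_bracket_f xa ya ya) na // oppr0 scale0r.
Qed.

Lemma root_space_line a e f x : a != 0 ->
  e \in root_space a -> f \in root_space (- a) -> x \in root_space a ->
  (a (vsproj t (lie e f)) : F) != 0 -> exists c, x = c *: e.
Proof.
move=> a0 ea fa xa s0.
apply: (weight_space_line (root_ad_nilpotent tC a0 ea) s0
  (u := (a (vsproj t (lie f x)) : F)) (f := f)).
- exact: root_bracket_e.
- exact: root_bracket_e.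
- by rewrite -(root_spaceE ea) // (lie_root_opp tC fa) ?opprK.
Qed.

(** Scaling [x] by [a h] amounts to bracketing it with [h]; invariance moves the
    bracket to [[x, w]], which is central and hence in the radical of the
    form. *)
Lemma killing_nilpotent_root n (X : n.-tuple L) a x w : basis_of fullv X ->
  a != 0 -> nilpotent_root a -> x \in root_space a -> w \in root_space (- a) ->
  killing X x w = 0.
Proof.
move=> Xb a0 na xa wa; have /lfunPn[h] := a0; rewrite zero_lfunE => ah.
apply/eqP; have /eqP : (a h : F) * killing X x w = 0.
  rewrite -killingZl -(root_spaceP _ _ xa h) killing_assoc //.
  exact/killing_central/(nilpotent_root_central a0).
by rewrite mulf_eq0 (negPf ah).
Qed.

(** A nonzero bracket [e = [y, x]] would span the root space of [b + a] and be
    part of an sl2-triple, with [f] opposite to it. The Killing form pairs [e]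
    and [f] nontrivially, yet by invariance it equals up to sign the pairing of
    [x] with [[y, f]], a vector of weight [- a], which vanishes. *)
Lemma lie_nilpotent_root_eq0 a b x y : a != 0 -> b + a != 0 ->
  nilpotent_root a -> ~ nilpotent_root (b + a) ->
  x \in root_space a -> y \in root_space b -> lie y x = 0.
Proof.
move=> a0 c0 na nc xa yb; apply: contrapT => /eqP e0.
apply: nc => e1 f e1c fc; apply: contrapT => /eqP s1.
have ec := root_space_lie yb xa; set e := lie y x in e0 ec.
have [k eE] := root_space_line c0 e1c fc ec s1.
have k0 : k != 0 by apply: contraNneq e0 => k0; rewrite eE k0 scale0r.
set s := ((b + a) (vsproj t (lie e f)) : F).
have s0 : s != 0 by rewrite /s eE lieZl !linearZ mulf_neq0.
have ht : lie e f \in t := lie_root_opp tC ec fc.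
have [n [X [mu hX]]] := ad_semisimple_eigenbasis (cartan_semisimple tC ht).
have Xb := hX.1; have hf := root_bracket_f ec fc fc.
have := killing_sl2_neq0 (root_ad_nilpotent tC c0 ec) _ s0 e0
  (root_bracket_e ec fc ec) hf hX.
have fn : ad_locally_nilpotent f.
  by apply: root_ad_nilpotent fc; rewrite ?oppr_eq0.
move=> /(_ fn); rewrite killing_assoc // lieC hf -scaleNr opprK killingZr //.
rewrite mulf_eq0 (negPf s0) /= /e lieC -scaleN1r killingZl // killing_assoc //.
rewrite (killing_nilpotent_root _ a0) ?mulr0 ?eqxx //.
(* [[y, f]] has weight [b - (b + a)]. *)
suff -> : - a = b + - (b + a) by exact: root_space_lie.
by rewrite opprD addrA subrr add0r.
Qed.

Definition nilpotent_roots : seq tdual :=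
  [seq a <- roots t | `[< nilpotent_root a >]].

(** For a reductive algebra this turns out to be the centre; it is the
    solvable ideal that reductivity is applied to. *)
Definition root_nilradical : {vspace L} :=
  (center L + \sum_(a <- nilpotent_roots) root_space a)%VS.

Local Notation N := root_nilradical.

Lemma nilpotent_rootsP a :
  reflect (a \in roots t /\ nilpotent_root a) (a \in nilpotent_roots).
Proof.
rewrite mem_filter andbC; apply: (iffP andP).
  by case=> ? /asboolP.
by case=> ? ?; split=> //; apply/asboolP.
Qed.

Lemma center_nilradical : (center L <= N)%VS.
Proof. exact: addvSl. Qed.

Lemma root_space_nilradical a x :
  a \in nilpotent_roots -> x \in root_space a -> x \in N.
Proof.
move=> aN xa; rewrite -[x]add0r memv_add ?mem0v //.
exact: memv_sum_seq xa.
Qed.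

Lemma nilradicalP x : x \in N ->
  exists z, exists2 v : tdual -> L, z \in center L /\ (forall a, v a \in root_space a)
  & x = z + \sum_(a <- nilpotent_roots) v a.
Proof.
move=> /memv_addP[z zc [w wN ->]]; exists z.
have [|v va ->] := memv_sum_seqP _ wN; first by rewrite filter_uniq ?fset_uniq.
by exists v.
Qed.

(** Bracketing a vector of nilpotent weight [a] with one of weight [b] gives a
    central vector if [b = - a], zero if [b + a] is a root that is not
    nilpotent, and otherwise a vector of nilpotent weight or zero. *)
Lemma nilradical_ideal : lie_ideal N.
Proof.
move=> y x /nilradicalP[z [v [zc va]] ->].
have [u ua ->] := weight_sum tC y.
rewrite lieDr lie_suml big1 => [|b _]; last by rewrite (centerP _ zc).
rewrite add0r lie_suml; apply: rpred_sum => b _.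
rewrite lie_sumr big_seq; apply: rpred_sum => a aN.
have /nilpotent_rootsP[/root_neq0 a0 na] := aN.
have [ba|c0] := eqVneq (b + a) 0.
  apply: (subvP center_nilradical); rewrite lieC rpredN.
  apply: (nilpotent_root_central a0 na (va a)).
  by move: ba => /eqP; rewrite addr_eq0 => /eqP <-.
have w_c := root_space_lie (ua b) (va a).
have [cr|cr] := boolP (b + a \in roots t); last first.
  rewrite (root_space_eq0 _ w_c) ?mem0v // inE (negPf c0).
  exact: cr.
have [nc|nc] := EM (nilpotent_root (b + a)).
  by apply: root_space_nilradical w_c; apply/nilpotent_rootsP.
by rewrite (lie_nilpotent_root_eq0 a0 c0 na nc (va a) (ua b)) mem0v.
Qed.

(** The conclusion of Engel's theorem, for the action of [M] on every subquotient
    [V / W] of the adjoint representation of the ambient algebra. *)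
Definition engel_property (M : {vspace L}) : Prop :=
  forall V W : {vspace L},
  (forall x y, x \in M -> y \in V -> lie x y \in V) ->
  (forall x y, x \in M -> y \in W -> lie x y \in W) ->
  ~~ (V <= W)%VS -> 
  exists v, [/\ v \in V, v \notin W & forall x, x \in M -> lie x v \in W].

Lemma engel_center : engel_property (center L).
Proof.
move=> V W _ _ /subvPn[v vV vW]; exists v; split=> // x xc.
by rewrite center_lier ?mem0v.
Qed.

(** The vectors of [V] that [M] sends into [W] are preserved by [v], because [v]
    normalises [M]; a suitable iterate of [v] on one of them outside [W] is
    killed by [v] modulo [W]. *)
Lemma engel_extend (M : {vspace L}) v : engel_property M ->
  (forall x y, x \in M -> y \in M -> lie x y \in M) ->
  (forall x, x \in M -> lie x v \in M) -> ad_locally_nilpotent v ->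
  engel_property (M + <[v]>)%VS.
Proof.
move=> engelM MM Mv nv V W MV MW VW.
have vM' : v \in (M + <[v]>)%VS := memv_add_line M v.
have MM' x : x \in M -> x \in (M + <[v]>)%VS by apply/subvP/addvSl.
have [||u [uV uW Mu]] := engelM V W _ _ VW; try by move=> x y /MM'; auto.
have [k vk] := nv u.
have vkW : iter k (lie v) u \in W by rewrite vk mem0v.
have [j [jW vjW]] := last_iterate_outside uW vkW.
exists (iter j (lie v) u); split=> // [|x].
  by elim: (j) => //= i; apply: MV.
move=> /memv_addP[y yM [_ /vlineP[c ->] ->]].
rewrite lieDl lieZl rpredD ?rpredZ //.
elim: (j) y yM => [|i IH] y yM /=; first exact: Mu.
rewrite lie_derivation rpredD ?IH ?Mv //.
by apply: MW; rewrite ?IH.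
Qed.

(** Enlarge [M] one dimension at a time. Its Engel property on [N / M] gives a
    vector of [N] outside [M] that normalises [M]. As the normaliser of [M] is
    stable under [t], it also contains the weight components of this vector,
    and one of them lies outside [M]; being a root vector, it is nilpotent, and
    [engel_extend] applies. Passing to a weight component matters because
    general elements of [N] are not known to be nilpotent beforehand. *)
Lemma engel_nilradical_from k (M : {vspace L}) :
  (center L <= M)%VS -> (M <= N)%VS ->
  (forall h x, h \in t -> x \in M -> lie h x \in M) ->
  (forall x y, x \in M -> y \in M -> lie x y \in M) ->
  engel_property M -> (\dim N - \dim M < k)%N -> engel_property N.
Proof.
elim: k M => [//|k IH] M ZM MN tM MM engelM le_k.
have [NM|NM] := boolP (N <= M)%VS.
  by rewrite -(subv_anti (introT andP (conj MN NM))).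
have [||v [vN vM Mv]] := engelM N M _ _ NM => //.
  by move=> x y _; apply: nilradical_ideal.
pose U := (N :&: transporter M M)%VS.
have UP x : reflect (x \in N /\ forall y, y \in M -> lie y x \in M) (x \in U).
  by rewrite memv_cap; apply: (iffP andP) => -[? /transporterP].
have tU h x : h \in t -> x \in U -> lie h x \in U.
  move=> ht /UP[xN xU]; apply/UP; split=> [|y yM]; first exact: nilradical_ideal.
  rewrite lie_derivation; apply: rpredD; last by apply: tM; rewrite ?xU.
  by apply: xU; rewrite lieC rpredN tM.
have [z [w [zc wa] vE]] := nilradicalP vN.
have zM : z \in M := subvP ZM _ zc.
have wU : {in nilpotent_roots, forall a, w a \in U}.
  apply: (weight_components tU wa); first by rewrite filter_uniq ?fset_uniq.
  have -> : \sum_(a <- nilpotent_roots) w a = v - z by rewrite vE addrC addKr.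
  rewrite rpredB //; apply/UP; split=> // [|y yM].
    exact: (subvP center_nilradical).
  exact: MM.
have [a [aN waM]] : exists a, a \in nilpotent_roots /\ w a \notin M.
  apply: contrapT => nw; case/negP: vM; rewrite vE rpredD // big_seq.
  apply: rpred_sum => a aN; apply: contrapT => /negP waM.
  by apply: nw; exists a.
have /UP[waN Mwa] := wU a aN; have /nilpotent_rootsP[/root_neq0 a0 _] := aN.
have MM' : (M <= M + <[w a]>)%VS := addvSl _ _.
apply: (IH (M + <[w a]>)%VS).
- exact: subv_trans ZM MM'.
- by rewrite subv_add MN -memvE.
- move=> h x ht /memv_addP[y yM [_ /vlineP[c ->] ->]].
  rewrite lieDr lieZr (root_spaceE (wa a) ht) rpredD ?rpredZ //.
    by rewrite (subvP MM') ?tM.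
  exact: memv_add_line.
- move=> x y /memv_addP[x' xM [_ /vlineP[c ->] ->]].
  move=> /memv_addP[y' yM [_ /vlineP[d ->] ->]].
  rewrite (subvP MM') // lieDr !lieDl !lieZr !lieZl liexx !scaler0 addr0.
  by rewrite (lieC y' (w a)) !rpredD ?rpredZ ?rpredN ?Mwa ?MM.
- exact: (engel_extend engelM MM Mwa (root_ad_nilpotent tC a0 (wa a))).
- rewrite -ltnS (leq_trans _ le_k) // ltnS ltn_sub2l //.
    by rewrite (ltn_leqif (dimv_leqif_sup MN)).
  rewrite (ltn_leqif (dimv_leqif_sup MM')).
  apply: contraNN waM => /subvP; apply.
  exact: memv_add_line.
Qed.

Lemma nilradical_engel : engel_property N.
Proof.
apply: (@engel_nilradical_from (\dim N - \dim (center L)).+1 (center L)) => //.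
- exact: center_nilradical.
- by move=> h x _ /centerP ->; rewrite mem0v.
- by move=> x y _ /centerP ->; rewrite mem0v.
- exact: engel_center.
Qed.

(** For an [N]-stable subspace [W] of [N] other than [N], the Engel property
    makes the transporter [W'] of [N] into [W] strictly larger than [W]. If a
    term of the derived series lies in [W'], the next one lies in [W]; so
    descend from [N] to zero, by induction on the codimension of [W]. *)
Lemma nilradical_solvable : lie_solvable N.
Proof.
have Nid := nilradical_ideal.
suff H k (W : {vspace L}) : (W <= N)%VS -> (forall x y, x \in N -> y \in W -> lie x y \in W) ->
    (\dim N - \dim W < k)%N -> exists n, (derived_series N n <= W)%VS.
  have [||n] := @H (\dim N - \dim (0 : {vspace L})).+1 0%VS _ _ (leqnn _).
  - exact: sub0v.
  - by move=> x y _; rewrite memv0 => /eqP ->; rewrite lie0r mem0v.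
  by rewrite subv0 => /eqP; exists n.
elim: k W => [//|k IH] W WN NW le_k.
have [NW'|NW'] := boolP (N <= W)%VS; first by exists 0%N.
have [|v [vN vW Nv]] := nilradical_engel _ NW NW' => //.
  by move=> x y _; apply: Nid.
pose W' := (N :&: transporter N W)%VS.
have W'P x : reflect (x \in N /\ forall y, y \in N -> lie y x \in W) (x \in W').
  by rewrite memv_cap; apply: (iffP andP) => -[? /transporterP].
have WW' : (W <= W')%VS.
  apply/subvP => x xW; apply/W'P; split; first exact: (subvP WN).
  by move=> y yN; apply: NW.
have [|||n nW'] := IH W'.
- exact: capvSl.
- move=> x y xN /W'P[yN Ny]; apply/W'P; split; first exact: Nid.
  by move=> z zN; apply: NW => //; apply: Ny.
- rewrite -ltnS (leq_trans _ le_k) // ltnS ltn_sub2l //.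
    by rewrite (ltn_leqif (dimv_leqif_sup WN)).
  rewrite (ltn_leqif (dimv_leqif_sup WW')).
  by apply: contraNN vW => /subvP; apply; apply/W'P.
exists n.+1; apply: lie_prod_subv => x y /(subvP nW')/W'P[xN _].
by move=> /(subvP nW')/W'P[_]; apply.
Qed.

(** Otherwise a root vector would lie in a solvable ideal, hence be central,
    while [t] acts on it by a nonzero weight. *)
Lemma root_not_nilpotent a : reductive L -> a \in roots t -> ~ nilpotent_root a.
Proof.
move=> Lred ar na; have aN : a \in nilpotent_roots by apply/nilpotent_rootsP.
have := ar; rewrite in_roots => /andP[/lfunPn[h]]; rewrite zero_lfunE => ah.
rewrite -vpick0; set x := vpick _ => x0.
have xa : x \in root_space a by apply: memv_pick.
have := Lred _ nilradical_ideal nilradical_solvable x (vsval h).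
move=> /(_ (root_space_nilradical aN xa))/eqP.
rewrite lieC oppr_eq0 (root_spaceP _ _ xa h) scaler_eq0 (negPf x0) orbF.
by rewrite (negPf ah).
Qed.

End NilpotentRoots.

(** * Coroots and the projection onto the Cartan subalgebra *)

Section Coroots.
Context {F : numFieldType} {L : lieAlgType F} (t : {vspace L}).
Hypothesis tC : cartan_subalgebra t.
Local Notation roots := Defs.roots.
Local Notation tdual := (dual (subvs_of t)).
Implicit Types (a b : tdual) (x y z h v w : L) (s : seq tdual).

(** Stated for lists of weights, [t] being the root space of weight [0]: it
    yields all direct sum decompositions needed below. *)
Lemma root_sums_cap0 s1 s2 : uniq (s1 ++ s2) ->
  (\sum_(a <- s1) root_space a :&: \sum_(a <- s2) root_space a = 0)%VS.
Proof.
move=> us; apply/eqP; rewrite -subv0; apply/subvP => x; rewrite memv_cap.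
have := us; rewrite cat_uniq => /and3P[us1 /hasPn s12 us2].
move=> /andP[/(memv_sum_seqP us1)[u uE xu] /(memv_sum_seqP us2)[w wE xw]].
pose v a := if a \in s1 then u a else - w a.
have v1 a : a \in s1 -> v a = u a by rewrite /v => ->.
have v0 : \sum_(a <- s1 ++ s2) v a = 0.
  rewrite big_cat /= (eq_big_seq _ v1) -xu.
  suff -> : \sum_(a <- s2) v a = - x by rewrite subrr.
  rewrite xw -sumrN; apply: eq_big_seq => a /s12 /negPf as1.
  by rewrite /v [a \in s1]as1.
rewrite memv0 xu big_seq big1 // => a as1; rewrite -v1 //.
apply: (root_space_free us _ v0); last by rewrite mem_cat as1.
by move=> b; rewrite /v; case: ifP => _; rewrite ?rpredN.
Qed.

Lemma cartan_add_sum s :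
  (t + \sum_(a <- s) root_space a = \sum_(a <- (0%R : tdual) :: s) root_space a)%VS.
Proof. by rewrite big_cons (root_space0 tC). Qed.

Lemma cartan_roots_cap0 : (t :&: \sum_(a <- roots t) root_space a = 0)%VS.
Proof.
have /root_sums_cap0 : uniq ([:: 0 : tdual] ++ roots t) := uniq_weights t.
by rewrite big_seq1 (root_space0 tC).
Qed.

Lemma cartan_proj_id h : h \in t -> vsval (cartan_proj t h) = h.
Proof.
move=> ht; rewrite /cartan_proj daddv_pi_id ?vsprojK //.
exact: cartan_roots_cap0.
Qed.

Lemma cartan_proj_root_space a x : a != 0 -> x \in root_space a ->
  cartan_proj t x = 0.
Proof.
move=> a0 xa; have cap0 := cartan_roots_cap0.
suff xr : x \in (\sum_(a <- roots t) root_space a)%VS.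
  rewrite /cartan_proj; apply/val_inj.
  have := daddv_pi_add cap0 (subvP (addvSr t _) x xr).
  rewrite (daddv_pi_id _ xr) 1?capvC // => /eqP.
  by rewrite -[X in _ == X]add0r (inj_eq (addIr x)) => /eqP ->; rewrite linear0.
have [ar|ar] := boolP (a \in roots t); first exact: memv_sum_seq xa.
by rewrite (root_space_eq0 _ xa) ?mem0v // inE negb_or a0.
Qed.

Lemma cartan_projZ (c : F) x : cartan_proj t (c *: x) = c *: cartan_proj t x.
Proof. by rewrite /cartan_proj !linearZ. Qed.

Lemma cartan_proj0 : cartan_proj t 0 = 0.
Proof. by rewrite /cartan_proj !linear0. Qed.

Lemma cartan_proj_sum (I : Type) (r : seq I) (P : pred I) (v : I -> L) :
  cartan_proj t (\sum_(i <- r | P i) v i) = \sum_(i <- r | P i) cartan_proj t (v i).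
Proof. by rewrite /cartan_proj !linear_sum. Qed.

Lemma cartan_proj_coroot a : cartan_proj t (vsval (coroot a)) = coroot a.
Proof. by apply/val_inj; apply: cartan_proj_id; apply: subvsP. Qed.

Hypothesis L_reductive : reductive L.

Lemma root_sl2 a : a \in roots t -> exists e f,
  [/\ e \in root_space a, f \in root_space (- a) &
      (a (vsproj t (lie e f)) : F) != 0].
Proof.
move=> /(root_not_nilpotent tC L_reductive) na; apply: contrapT => H; apply: na.
move=> x y xa ya; apply/eqP; apply: contrapT => /negP n0; apply: H.
by exists x, y.
Qed.

(** With an sl2-triple at hand both root spaces are lines, so their bracket is
    the line of [[e, f]], which contains the coroot. *)
Lemma coroot_bracket a : a \in roots t ->
  a (coroot a) = 2 /\ exists e f c,
  [/\ (forall x, x \in root_space a -> exists k, x = k *: e),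
      (forall x, x \in root_space (- a) -> exists k, x = k *: f),
      e \in root_space a, f \in root_space (- a) &
      c != 0 /\ lie e f = c *: vsval (coroot a)].
Proof.
move=> ar; have [e [f [ea fa s0]]] := root_sl2 ar; have a0 := root_neq0 ar.
set s : F := a _ in s0.
have eline x : x \in root_space a -> exists k, x = k *: e.
  by move=> xa; apply: (root_space_line tC a0 ea fa).
have fline x : x \in root_space (- a) -> exists k, x = k *: f.
  move=> xa; apply: (@root_space_line _ _ _ tC (- a) f e) => //; rewrite ?oppr_eq0 ?opprK //.
  by rewrite lieC !linearN /= opp_lfunE opprK.
have heft : lie e f \in t := lie_root_opp tC ea fa.
have [cP c2] : is_coroot a (coroot a).
  apply: xgetPex; exists ((2 / s) *: vsproj t (lie e f)); split.
    by rewrite linearZ /= vsprojK // memvZ // mem_lie_prod.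
  by rewrite linearZ /= -/s; apply: divfK.
split=> //; exists e, f.
have /vlineP[k kE] : vsval (coroot a) \in <[lie e f]>%VS.
  apply: subvP cP; apply: lie_prod_subv => x y /eline[k ->] /fline[l ->].
  by rewrite lieZl lieZr !memvZ ?memv_line.
have k0 : k != 0.
  apply/eqP => k0; have := c2; rewrite -[coroot a]vsvalK kE k0 scale0r linear0 linear0.
  by move/eqP; rewrite eq_sym pnatr_eq0.
exists k^-1; split=> //; split; first by rewrite invr_eq0.
by rewrite kE scalerA mulVf // scale1r.
Qed.

Lemma lie_root_coroot a x y : a \in roots t ->
  x \in root_space a -> y \in root_space (- a) ->
  exists c, lie x y = c *: vsval (coroot a).
Proof.
move=> /coroot_bracket[_ [e [f [c [el fl _ _ [_ efE]]]]]] /el[k ->] /fl[l ->].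
by exists (k * l * c); rewrite lieZl lieZr efE !scalerA.
Qed.

Lemma root_pairing_nondegenerate a x : a \in roots t -> x \in root_space a -> x != 0 ->
  exists y c, [/\ y \in root_space (- a), c != 0 & lie x y = c *: vsval (coroot a)].
Proof.
move=> /coroot_bracket[_ [e [f [c [el fl ea fa [c0 efE]]]]]] /el[k ->] x0.
exists f, (k * c); split=> //; last by rewrite lieZl efE scalerA.
by rewrite mulf_neq0 //; apply: contraNneq x0 => ->; rewrite scale0r.
Qed.

(** Only brackets of opposite root vectors have a component in [t] that can be
    nonzero, and this component is a multiple of the coroot. *)
Lemma character_lie_eq0 (mu : tdual) s y z :
  (forall a, a \in s -> a \in roots t /\ mu (coroot a) = 0) -> uniq s ->
  y \in (t + \sum_(a <- s) root_space a)%VS -> mu (cartan_proj t (lie y z)) = 0.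
Proof.
move=> sP us; have us0 : uniq ((0 : tdual) :: s).
  by rewrite /= us andbT; apply/negP => /sP[/root_neq0]; rewrite eqxx.
rewrite cartan_add_sum => /(memv_sum_seqP us0)[u ua ->].
have [v va ->] := weight_sum tC z.
rewrite lie_suml cartan_proj_sum linear_sum big_seq big1 // => a as_.
rewrite lie_sumr cartan_proj_sum linear_sum big1 // => b _.
have abv := root_space_lie (ua a) (va b).
have [ab0|ab0] := eqVneq (a + b) 0; last first.
  by rewrite (cartan_proj_root_space ab0 abv) linear0.
move: as_; rewrite inE => /predU1P[a0|/sP[ar mua]].
  rewrite (cartan_commutes tC) ?cartan_proj0 ?linear0 //.
    by have := ua a; rewrite a0 root_space0.
  by have := va b; move: ab0; rewrite a0 add0r => ->; rewrite root_space0.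
have vb : v b \in root_space (- a).
  by move: ab0 => /eqP; rewrite addrC addr_eq0 => /eqP <-.
have [c ->] := lie_root_coroot ar (ua a) vb.
by rewrite cartan_projZ linearZ /= cartan_proj_coroot mua scaler0.
Qed.

Lemma cartan_proj_lie_notin b s y z : b \notin s -> b != 0 -> uniq s -> 0 \notin s ->
  y \in (t + \sum_(a <- s) root_space a)%VS -> z \in root_space (- b) ->
  cartan_proj t (lie y z) = 0.
Proof.
move=> bs b0 us s0 + zb; have us0 : uniq ((0 : tdual) :: s) by rewrite /= s0.
rewrite cartan_add_sum => /(memv_sum_seqP us0)[u ua ->].
rewrite lie_suml cartan_proj_sum big_seq big1 // => a as_.
apply: cartan_proj_root_space (root_space_lie (ua a) zb).
rewrite subr_eq0; apply: contraTneq as_ => ->.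
by rewrite inE negb_or b0.
Qed.

End Coroots.

(** * Graded subspaces of truncated current algebras *)

Section GradedSubspaces.
Context {F : fieldType} (r : nat) {L : lieAlgType F}.
Implicit Types U V : 'I_r -> {vspace L}.

Lemma graded_add U V :
  (graded U + graded V = graded (fun i => U i + V i))%VS.
Proof.
by rewrite /graded -big_split; apply: eq_bigr => i _; rewrite limgD.
Qed.

Lemma graded_cap0 U V : (forall i, U i :&: V i = 0)%VS ->
  (graded U :&: graded V = 0)%VS.
Proof.
move=> UV0; apply/eqP; rewrite -subv0; apply/subvP => Y.
rewrite memv_cap => /andP[/gradedP YU /gradedP YV]; rewrite memv0.
apply/eqP/ffunP => i; apply/eqP; rewrite ffunE -memv0 -(UV0 i).
by rewrite memv_cap YU YV.
Qed.

Lemma graded_full U : (forall i, U i = fullv) -> graded U = fullv.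
Proof.
move=> UE; apply/vspaceP => Y; rewrite memvf.
by apply/gradedP => i; rewrite UE memvf.
Qed.

End GradedSubspaces.

(** * Stabilisers and strata *)

Section Strata.
Context {F : numFieldType} {L : lieAlgType F} (t : {vspace L}).
Hypothesis tC : cartan_subalgebra t.
Hypothesis L_reductive : reductive L.
Local Notation roots := Defs.roots.
Local Notation tdual := (dual (subvs_of t)).
Context (r : nat) (psi : nat -> {fset tdual}).
Hypothesis psi_filtration : parabolic_filtration r psi.
Local Notation phi := (levi_factor psi).
Implicit Types (a b : tdual) (x y z : L) (Y Z : current r L).

Lemma mem_enum_fset (p : {fset tdual}) a : (a \in enum_fset p) = (a \in p).
Proof. by []. Qed.

Lemma mem_opp (p : {fset tdual}) a :
  (a \in [fset (- b)%R | b in p]%fset) = (- a \in p).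
Proof.
apply/imfsetP/idP => [[b bp ->]|ap]; first by rewrite opprK.
by exists (- a); rewrite ?opprK.
Qed.

Lemma mem_levi_factor i a : (a \in phi i) = (a \in psi i) && (- a \in psi i).
Proof. by rewrite in_fsetI mem_opp. Qed.

Lemma levi_factorN i a : (- a \in phi i) = (a \in phi i).
Proof. by rewrite !mem_levi_factor opprK andbC. Qed.

Lemma psi_roots i a : a \in psi i -> a \in roots t.
Proof. by have [/(_ i)[/fsubsetP psiR _ _] _ _] := psi_filtration => /psiR. Qed.

Lemma psi_total i a : a \in roots t -> (a \in psi i) || (- a \in psi i).
Proof.
have [/(_ i)[_ _ psiU] _ _] := psi_filtration.
by rewrite -psiU in_fsetU mem_opp.
Qed.

Lemma rootsN a : (- a \in roots t) = (a \in roots t).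
Proof.
have [/(_ 0%N)[_ _ psiU] _ _] := psi_filtration.
by rewrite -psiU !in_fsetU !mem_opp opprK orbC.
Qed.

Lemma phi_roots i a : a \in phi i -> a \in roots t.
Proof. by rewrite mem_levi_factor => /andP[/psi_roots]. Qed.

Lemma phi_mono i j a : (i <= j)%N -> a \in phi i -> a \in phi j.
Proof.
have [_ psiS _] := psi_filtration.
have psi_mono b : (i <= j)%N -> b \in psi i -> b \in psi j.
  elim: j => [|j IH]; first by rewrite leqn0 => /eqP ->.
  rewrite leq_eqVlt => /predU1P[->//|ij] bi.
  by apply: (fsubsetP (psiS j)); apply: IH.
by move=> ij; rewrite !mem_levi_factor => /andP[/(psi_mono _ ij) -> /(psi_mono _ ij)].
Qed.

Lemma phi_top a : a \in roots t -> a \in phi r.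
Proof.
have [_ _ psir] := psi_filtration.
by move=> ar; rewrite mem_levi_factor (psir r) // rootsN ar.
Qed.

Definition unipotent_roots i : {fset tdual} := (psi i `\` phi i)%fset.

Lemma mem_unipotent_roots i a :
  (a \in unipotent_roots i) = (a \in psi i) && (- a \notin psi i).
Proof.
rewrite in_fsetD mem_levi_factor negb_and.
by case: (a \in psi i); rewrite ?andbF ?andbT.
Qed.

Local Notation nilp_seq i :=
  ([seq - a | a <- unipotent_roots i] ++ unipotent_roots i).

(** The weights of the Levi part of level [i], then those of the negative and of
    the positive nilpotent part; being distinct, they make these parts
    independent. *)
Lemma uniq_level i : uniq ((0 :: phi i) ++ nilp_seq i).
Proof.
have n0 (p : {fset tdual}) : (forall a, a \in p -> a \in roots t) -> 0 \notin p.
  by move=> pR; apply/negP => /pR/root_neq0; rewrite eqxx.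
have uR a : a \in unipotent_roots i -> a \in roots t.
  by rewrite mem_unipotent_roots => /andP[/psi_roots].
have u1 : uniq (0 :: phi i).
  by rewrite /= fset_uniq andbT; apply: (n0 (phi i)) => a /phi_roots.
have u2 : uniq (nilp_seq i).
  rewrite cat_uniq (map_inj_uniq oppr_inj) !fset_uniq andbT /=.
  apply/hasPn => a; rewrite mem_enum_fset => au.
  apply/negP => /mapP[b]; rewrite mem_enum_fset => bu ab.
  by move: au bu; rewrite !mem_unipotent_roots ab opprK => /andP[_ /negPf ->].
rewrite cat_uniq u1 u2 andbT /=; apply/hasPn => a.
rewrite mem_cat in_cons !mem_enum_fset negb_or => /orP[/mapP[b]|au]; last first.
  rewrite (root_neq0 (uR a au)) mem_levi_factor.
  by move: au; rewrite mem_unipotent_roots => /andP[_ /negPf ->]; rewrite andbF.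
rewrite mem_enum_fset => bu ->.
rewrite oppr_eq0 (root_neq0 (uR b bu)) mem_levi_factor.
by move: bu; rewrite mem_unipotent_roots => /andP[_ /negPf ->].
Qed.

Lemma mem_level i a : a \in weights t -> a \in (0 :: phi i) ++ nilp_seq i.
Proof.
rewrite mem_cat !in_cons !mem_enum_fset; case: eqP => //= _ /(psi_total i).
rewrite mem_cat -[X in X \in map _ _]opprK (mem_map oppr_inj) !mem_enum_fset.
rewrite !mem_unipotent_roots mem_levi_factor opprK.
by case: (a \in _); case: (- a \in _).
Qed.

Local Notation Lv i := (t + \sum_(a <- phi i) root_space a)%VS.
Local Notation Up i := (\sum_(a <- unipotent_roots i) root_space a)%VS.
Local Notation Um i := (\sum_(a <- unipotent_roots i) root_space (- a))%VS.

Lemma level_nilp i : (Um i + Up i)%VS = (\sum_(a <- nilp_seq i) root_space a)%VS.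
Proof. by rewrite big_cat big_map. Qed.

Lemma level_full i : (Lv i + (Um i + Up i) = fullv)%VS.
Proof.
rewrite level_nilp (cartan_add_sum tC).
apply/vspaceP => x; rewrite memvf -big_cat.
have [v va ->] := weight_sum tC x.
rewrite [X in X \in _]big_seq; apply: rpred_sum => a aw.
exact: memv_sum_seq (mem_level i aw) (va a).
Qed.

Lemma level_cap0 i : (Lv i :&: (Um i + Up i) = 0)%VS.
Proof. by rewrite level_nilp (cartan_add_sum tC) (root_sums_cap0 (uniq_level i)). Qed.

Lemma level_nilp_cap0 i : (Um i :&: Up i = 0)%VS.
Proof.
have := uniq_level i; rewrite cat_uniq => /and3P[_ _ /root_sums_cap0].
by rewrite big_map.
Qed.

Local Notation l := (levi r phi).
Local Notation up := (uplus r psi).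
Local Notation um := (uminus r psi).

Lemma levi_full : (l + (um + up) = fullv)%VS.
Proof. by rewrite !graded_add; apply: graded_full => i; apply: level_full. Qed.

Lemma levi_cap0 : (l :&: (um + up) = 0)%VS.
Proof. by rewrite graded_add; apply: graded_cap0 => i; apply: level_cap0. Qed.

Lemma nilp_cap0 : (um :&: up = 0)%VS.
Proof. by apply: graded_cap0 => i; apply: level_nilp_cap0. Qed.

Context (lam : 'I_r -> tdual).
Local Notation f := (extend lam).

Lemma extend_nilp Y : Y \in (um + up)%VS -> f Y = 0.
Proof.
rewrite graded_add => /gradedP Yi; rewrite extendE big1 // => i _.
suff -> : cartan_proj t (Y i) = 0 by rewrite linear0.
have := Yi i; rewrite level_nilp.
have := uniq_level i; rewrite cat_uniq => /and3P[_ n0 un].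
move=> /(memv_sum_seqP un)[v va ->].
rewrite cartan_proj_sum big_seq big1 // => a an.
apply: cartan_proj_root_space (va a) => //.
by apply: contraNneq n0 => a0; apply/hasP; exists a; rewrite // a0 mem_head.
Qed.

(** The projection onto the Levi part can be dropped because the extended
    functional vanishes on the complement. *)
Lemma B_formE Y Z : B_form psi lam Y Z = f (lie Y Z).
Proof.
rewrite /B_form /levi_char /levi_proj vsprojK ?memv_pi //.
have := daddv_pi_add levi_cap0 (w := lie Y Z).
rewrite levi_full memvf => /(_ isT) {2}<-.
by rewrite linearD /= [X in _ + X]extend_nilp ?memv_pi // addr0.
Qed.

Lemma extend_lie Y Z : f (lie Y Z) =
  \sum_(k < r) \sum_(i < r) \sum_(j < r | (i + j == k)%N)
    lam k (cartan_proj t (lie (Y i) (Z j))).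
Proof.
rewrite extendE; apply: eq_bigr => k _; rewrite ffunE cartan_proj_sum linear_sum.
by apply: eq_bigr => i _; rewrite cartan_proj_sum linear_sum.
Qed.

Hypothesis lam_Z : in_Z phi lam.

(** Both [i <= k] and the growth of the Levi filtration enter: the conditions on
    [lam] at level [k] cover the roots of all lower levels. *)
Lemma lam_lie_phi (k : 'I_r) i y z : (i <= k)%N -> y \in Lv i ->
  lam k (cartan_proj t (lie y z)) = 0.
Proof.
move=> ik; apply: (character_lie_eq0 tC L_reductive); last exact: fset_uniq.
move=> a ai; split; first exact: phi_roots ai.
by apply: lam_Z; apply: phi_mono ai.
Qed.

(** A bracket with an element of degree [i] only reaches degrees [k >= i]. *)
Lemma levi_sub_stab : (l <= coad_stab f)%VS.
Proof.
apply/subvP => Y /gradedP Yl; apply/coad_stabP => Z; rewrite extend_lie.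
rewrite big1 // => k _; rewrite big1 // => i _; rewrite big1 // => j /eqP ijk.
by apply: lam_lie_phi (Yl i); rewrite -ijk leq_addr.
Qed.

(** Induct on the degree [i]. Let [b] be a root outside [phi i] for which [Y i]
    has a nonzero component, and let [d + 1] be the first level at which [b]
    enters the Levi filtration. Testing [Y] against a vector [z] of weight
    [- b] in degree [d - i] isolates one term. Degrees of [Y] below [i] do not
    contribute, by induction; degrees above [i] reach levels beyond [d], where
    [lam] vanishes on the coroot of [b]; the degree [i] contributes a nonzero
    multiple of the value of [lam d] at the coroot of [b], which is nonzero on
    the stratum. *)
Lemma stratum_stab_sub_levi : in_stratum phi lam -> (coad_stab f <= l)%VS.
Proof.
move=> [_ lamN]; apply/subvP => Y /coad_stabP Ystab; apply/gradedP => i.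
have [n] := ubnP i; elim: n i => // n IH i; rewrite ltnS => i_n.
have {}IH (i' : 'I_r) : (i' < i)%N -> Y i' \in Lv i'.
  by move=> i'i; apply: IH; apply: leq_trans i_n.
have [v va vE] := weight_sum tC (Y i).
rewrite vE big_seq; apply: rpred_sum => b bw.
have [b0|b0] := eqVneq b 0.
  by rewrite (subvP (addvSl _ _)) // -(root_space0 tC) -b0.
have br : b \in roots t by move: bw; rewrite inE (negPf b0).
have [bi|bi] := boolP (b \in phi i).
  by rewrite (subvP (addvSr _ _)) //; apply: memv_sum_seq (va b).
suff -> : v b = 0 by exact: mem0v.
apply/eqP; apply: contraT => vb0; exfalso.
have exd : exists d, b \in phi d by exists r; apply: phi_top.
case: (ex_minnP exd) => -[|d] bd dmin.
  by move: bi; rewrite (phi_mono _ bd).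
have id_ : (i <= d)%N.
  by rewrite leqNgt; apply: contraNN bi => di; apply: phi_mono bd.
have dr : (d < r)%N by apply: dmin; apply: phi_top.
have jr : (d - i < r)%N by rewrite (leq_ltn_trans _ dr) ?leq_subr.
(* [z] is placed in degree [j = d - i], so that [Y i] meets it in degree [d]. *)
pose k0 := Ordinal dr; pose j := Ordinal jr.
have [z [c [zb c0 zE]]] := root_pairing_nondegenerate tC L_reductive br (va b) vb0.
have := Ystab (monomial j z); rewrite extend_lie.
have term0 (k i' j' : 'I_r) : (i' + j' == k)%N -> ~~ ((i' == i) && (j' == j)) ->
    lam k (cartan_proj t (lie (Y i') (monomial j z j'))) = 0.
  rewrite monomialE => /eqP ijk; case: (j' =P j) => [jE|_ _]; last first.
    by rewrite lie0r cartan_proj0 linear0.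
  rewrite andbT -val_eqE neq_ltn => /orP[i'i|ii'].
    rewrite (cartan_proj_lie_notin tC _ b0 _ _ (IH i' i'i) zb) ?linear0 ?fset_uniq //.
      by apply: contraNN bi; apply/phi_mono/ltnW.
    by apply/negP => /phi_roots/root_neq0; rewrite eqxx.
  (* [i' > i], so that [k = i' + (d - i)] is at least [d + 1]. *)
  have bk : b \in phi k.
    by apply: phi_mono bd; rewrite -ijk jE /= -{1}(subnKC id_) -addSn leq_add2r.
  rewrite lieC -scaleN1r cartan_projZ linearZ /=.
  rewrite (@lam_lie_phi k k z) ?mulr0 ?scaler0 //.
  rewrite (subvP (addvSr _ _)) //; apply: memv_sum_seq zb.
  by rewrite mem_enum_fset levi_factorN.
rewrite (bigD1 k0) //= [X in _ + X]big1 => [|k kk0]; last first.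
  rewrite big1 // => i' _; rewrite big1 // => j' ijk; apply: term0 => //.
  apply: contraNN kk0 => /andP[/eqP i'i /eqP j'j].
  by rewrite -val_eqE /= -(eqP ijk) i'i j'j /= subnKC.
rewrite (bigD1 i) //= [X in _ + X + _]big1 => [|i' i'i]; last first.
  by rewrite big1 // => j' ijk; apply: term0; rewrite // (negPf i'i).
rewrite (bigD1 j) /= ?subnKC // [X in _ + X + _ + _]big1 => [|j' /andP[ijk j'j]]; last first.
  by apply: term0; rewrite // (negPf j'j) andbF.
rewrite !addr0 monomialE eqxx vE lie_suml cartan_proj_sum.
rewrite (bigD1_seq _ bw) ?uniq_weights //= big1 => [|a ab]; last first.
  apply: (cartan_proj_root_space tC _ (root_space_lie (va a) zb)).
  by rewrite subr_eq0.
rewrite addr0 zE cartan_projZ linearZ /= (cartan_proj_coroot tC).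
move/eqP; rewrite mulf_eq0 (negPf c0) /= => /eqP.
apply: (lamN k0); rewrite in_fsetD /= bd andbT.
by apply/negP => /dmin; rewrite ltnn.
Qed.

(** If [lam i] vanished at the coroot of a root [a] entering at level [i + 1],
    then so would all later ones, and the root space of [a] in degree [i] would
    stabilise [lam] without lying in the Levi part. *)
Lemma stab_eq_levi_stratum : l = coad_stab f -> in_stratum phi lam.
Proof.
move=> lE; split=> // i a; rewrite in_fsetD => /andP[ai ai1] lam0.
have ar := phi_roots ai1; have := ar; rewrite in_roots => /andP[a0].
rewrite -vpick0; set x := vpick _ => x0.
have xa : x \in root_space a by apply: memv_pick.
have : monomial i x \in l.
  rewrite lE; apply/coad_stabP => Z; rewrite extend_lie.
  rewrite big1 // => k _; rewrite big1 // => i' _; rewrite big1 // => j /eqP ijk.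
  rewrite monomialE; case: eqP => [i'i|_]; last by rewrite lie0l cartan_proj0 linear0.
  apply: (@character_lie_eq0 _ _ _ tC L_reductive _ [:: a]) => //; last first.
    by rewrite big_seq1 (subvP (addvSr _ _)).
  move=> b; rewrite inE => /eqP ->; split=> //.
  have [ik|] := ltnP i k; first by apply: lam_Z; apply: phi_mono ai1.
  move=> ki; suff -> : k = i by [].
  by apply/val_inj/eqP; rewrite eqn_leq ki /= -ijk i'i leq_addr.
move=> /gradedP/(_ i); rewrite monomialE eqxx (cartan_add_sum tC) => xl.
have /root_sums_cap0 : uniq ((0 :: phi i) ++ [:: a]).
  have := uniq_level i; rewrite !cat_uniq => /andP[-> _] /=.
  by rewrite !andbT orbF inE negb_or a0.
rewrite big_seq1 => /vspaceP/(_ x); rewrite memv_cap xl xa memv0 => /esym.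
by rewrite (negPf x0).
Qed.

Lemma to_tangent_eqP Y Z :
  to_tangent f Y = to_tangent f Z <-> Y - Z \in coad_stab f.
Proof.
rewrite memv_ker linearB subr_eq0 /= -!to_tangentE.
by split=> [-> | /eqP/subvs_inj].
Qed.

(** The nilpotent component of an element of the stabiliser is again in the
    stabiliser, hence has zero image in the tangent space. *)
Lemma B_kks_stab_eq_levi : B_is_kks_restriction psi lam -> l = coad_stab f.
Proof.
move=> [/bij_inj inj _]; apply/eqP; rewrite eqEsubv levi_sub_stab /=.
apply/subvP => Y Ys; have : Y \in (l + (um + up))%VS by rewrite levi_full memvf.
move=> /memv_addP[Yl Yl_l [Yn]] + YE.
move=> /memv_addP[Ym Ymu [Yp Ypu YnE]].
have Yns : Yn \in coad_stab f.
  by rewrite -[Yn](addKr Yl) -YE rpredD ?rpredN ?(subvP levi_sub_stab _ Yl_l).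
have E : @nilp_to_tangent _ _ t r psi lam (vsproj up Yp, vsproj um Ym) =
    @nilp_to_tangent _ _ t r psi lam (0, 0).
  apply/to_tangent_eqP; rewrite /= !vsprojK //.
  by rewrite addr0 subr0 addrC -YnE.
case: (inj _ _ E) => /(congr1 vsval) + /(congr1 vsval); rewrite !vsprojK // !linear0 => p0 m0.
by rewrite YE YnE p0 m0 !addr0.
Qed.

(** The compatibility of the two forms always holds; the bijectivity says that
    the nilpotent part is a complement of the stabiliser. *)
Lemma stab_eq_levi_B_kks : l = coad_stab f -> B_is_kks_restriction psi lam.
Proof.
move=> lE; split; last first.
  move=> Y Z; rewrite B_formE /nilp_to_tangent kksE /=.
  by rewrite addr0 add0r.
have inj : injective (@nilp_to_tangent _ _ t r psi lam).
  move=> [Yp Ym] [Zp Zm] /to_tangent_eqP; rewrite -lE /= => Dl.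
  have Dp : vsval Yp - vsval Zp \in up by rewrite rpredB ?subvsP.
  have Dm : vsval Ym - vsval Zm \in um by rewrite rpredB ?subvsP.
  have D0 : (vsval Ym - vsval Zm) + (vsval Yp - vsval Zp) = 0.
    apply/eqP; rewrite -memv0 -levi_cap0 memv_cap memv_add // andbT.
    by move: Dl; rewrite opprD addrACA addrC.
  have m0 : vsval Ym - vsval Zm = 0.
    apply/eqP; rewrite -memv0 -nilp_cap0 memv_cap Dm /=.
    by move/eqP: D0; rewrite addr_eq0 => /eqP ->; rewrite rpredN.
  move: D0; rewrite m0 add0r => p0.
  by congr pair; apply/val_inj/eqP; rewrite -subr_eq0 ?m0 ?p0.
have surj w : exists YY, @nilp_to_tangent _ _ t r psi lam YY = w.
  have /memv_imgP[X _ XE] := subvsP w.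
  have : X \in (l + (um + up))%VS by rewrite levi_full memvf.
  move=> /memv_addP[Xl Xl_l [Xn + XlE]].
  move=> /memv_addP[Xm Xmu [Xp Xpu XnE]].
  exists (vsproj up Xp, vsproj um Xm); apply/val_inj.
  rewrite -[LHS]/(vsval _) to_tangentE /= !vsprojK // [RHS]XE XlE XnE.
  rewrite [Xm + _]addrC [RHS]linearD /=.
  by move: Xl_l; rewrite lE memv_ker => /eqP ->; rewrite add0r.
have [g gK] := choice surj.
by exists g => // YY; apply: inj; rewrite gK.
Qed.

End Strata.

(** * The equivalence *)

Theorem theorem14p2p3 (R : realType) (g : lieAlgType R[i]) (t : {vspace g})
    (g_reductive : reductive g) (t_cartan : cartan_subalgebra t)
    (r : nat) (r_gt0 : (0 < r)%N)
    (psi : nat -> {fset dual (subvs_of t)})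
    (psi_filtration : parabolic_filtration r psi)
    (lam : 'I_r -> dual (subvs_of t))
    (lam_Z : in_Z (levi_factor psi) lam) :
  [<-> B_is_kks_restriction psi lam;
       in_stratum (levi_factor psi) lam;
       levi r (levi_factor psi) = coad_stab (extend lam)].
Proof.
tfae.
- move=> /(B_kks_stab_eq_levi t_cartan g_reductive psi_filtration lam_Z).
  exact: (stab_eq_levi_stratum t_cartan g_reductive psi_filtration lam_Z).
- move=> strat; apply/eqP; rewrite eqEsubv.
  rewrite (levi_sub_stab t_cartan g_reductive psi_filtration lam_Z) /=.
  exact: (stratum_stab_sub_levi t_cartan g_reductive psi_filtration lam_Z strat).
- exact: (stab_eq_levi_B_kks t_cartan psi_filtration).
Qed.
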